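(* Let $X_1\subset X_2\subset\cdots$ be an increasing sequence of finite-dimensional Banach spaces (each $X_n$ a subspace of $X_{n+1}$ with the induced norm) with $\dim X_n\to\infty$. Then there exists an infinite connected unweighted graph $H$ of maximum degree $3$ (with its shortest path metric) such that for every Banach space $X$ the following are equivalent: (a) $H$ admits a bilipschitz embedding into $X$; (b) the spaces $\{X_n\}_{n=1}^\infty$ admit uniformly isomorphic embeddings into $X$.
   Context: Graphs carry the shortest path metric. Linear embeddings $T_n:X_n\to X$ are uniformly isomorphic if $\sup_n\|T_n\|\cdot\|T_n^{-1}|_{T_n(X_n)}\|<\infty$. A bilipschitz embedding is a map $f$ with $r d(u,v)\le d(f(u),f(v))\le rC d(u,v)$ for some $r>0$, $C<\infty$ and all $u,v$. *)

(* Defs.v *)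
From Stdlib Require Import Reals Lra List.
Open Scope R_scope.

Record NormedSpace : Type := {
  ns_car :> Type;
  ns_zero : ns_car;
  ns_add : ns_car -> ns_car -> ns_car;
  ns_opp : ns_car -> ns_car;
  ns_scal : R -> ns_car -> ns_car;
  ns_norm : ns_car -> R;
  ns_add_assoc : forall x y z, ns_add x (ns_add y z) = ns_add (ns_add x y) z;
  ns_add_comm : forall x y, ns_add x y = ns_add y x;
  ns_add_0 : forall x, ns_add ns_zero x = x;
  ns_add_opp : forall x, ns_add x (ns_opp x) = ns_zero;
  ns_scal_assoc : forall a b x, ns_scal a (ns_scal b x) = ns_scal (a * b) x;
  ns_scal_1 : forall x, ns_scal 1 x = x;
  ns_scal_distr_l : forall a x y, ns_scal a (ns_add x y) = ns_add (ns_scal a x) (ns_scal a y);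
  ns_scal_distr_r : forall a b x, ns_scal (a + b) x = ns_add (ns_scal a x) (ns_scal b x);
  ns_norm_nonneg : forall x, 0 <= ns_norm x;
  ns_norm_eq0 : forall x, ns_norm x = 0 -> x = ns_zero;
  ns_norm_scal : forall a x, ns_norm (ns_scal a x) = Rabs a * ns_norm x;
  ns_norm_triangle : forall x y, ns_norm (ns_add x y) <= ns_norm x + ns_norm y
}.

Arguments ns_zero {_}.
Arguments ns_add {_} _ _.
Arguments ns_opp {_} _.
Arguments ns_scal {_} _ _.
Arguments ns_norm {_} _.

Definition ns_sub {X : NormedSpace} (x y : X) : X := ns_add x (ns_opp y).

Definition complete (X : NormedSpace) : Prop :=
  forall u : nat -> X,
    (forall eps, 0 < eps -> exists N, forall m n, (N <= m)%nat -> (N <= n)%nat ->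
        ns_norm (ns_sub (u m) (u n)) < eps) ->
    exists l : X, forall eps, 0 < eps -> exists N, forall n, (N <= n)%nat ->
        ns_norm (ns_sub (u n) l) < eps.

Record BanachSpace : Type := {
  bs_space :> NormedSpace;
  bs_complete : complete bs_space
}.

Definition is_subspace {Z : NormedSpace} (S : Z -> Prop) : Prop :=
  S ns_zero /\ (forall x y, S x -> S y -> S (ns_add x y)) /\
  (forall a x, S x -> S (ns_scal a x)).

Fixpoint lincomb {Z : NormedSpace} (l : list (R * Z)) : Z :=
  match l with
  | nil => ns_zero
  | (c, v) :: l' => ns_add (ns_scal c v) (lincomb l')
  end.

Definition lin_indep {Z : NormedSpace} (vs : list Z) : Prop :=
  forall cs : list R, length cs = length vs ->
    lincomb (combine cs vs) = ns_zero -> Forall (fun c => c = 0) cs.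

Definition finite_dim {Z : NormedSpace} (S : Z -> Prop) : Prop :=
  exists vs : list Z, Forall S vs /\
    forall x, S x -> exists cs : list R, length cs = length vs /\ x = lincomb (combine cs vs).

Definition dim_ge {Z : NormedSpace} (S : Z -> Prop) (k : nat) : Prop :=
  exists vs : list Z, length vs = k /\ Forall S vs /\ lin_indep vs.

Definition linear_on {Z X : NormedSpace} (S : Z -> Prop) (T : Z -> X) : Prop :=
  (forall x y, S x -> S y -> T (ns_add x y) = ns_add (T x) (T y)) /\
  (forall a x, S x -> S (ns_scal a x) -> T (ns_scal a x) = ns_scal a (T x)).

(** The spaces (S n) (with the norm induced from Z) admit uniformly
    isomorphic embeddings into X: linear T_n with ||T_n|| <= b_n,
    ||T_n^{-1}|| <= a_n on T_n(S n), and sup_n a_n b_n < oo. *)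
Definition unif_iso_embed {Z : NormedSpace} (S : nat -> Z -> Prop) (X : NormedSpace) : Prop :=
  exists C : R, forall n, exists (T : Z -> X) (a b : R),
    linear_on (S n) T /\ 0 <= a /\ 0 <= b /\ a * b <= C /\
    (forall x, S n x -> ns_norm (T x) <= b * ns_norm x) /\
    (forall x, S n x -> ns_norm x <= a * ns_norm (T x)).

Definition simple_graph {V : Type} (E : V -> V -> Prop) : Prop :=
  (forall u v, E u v -> E v u) /\ (forall v, ~ E v v).

Inductive walk {V : Type} (E : V -> V -> Prop) : V -> V -> nat -> Prop :=
  | walk_nil : forall v, walk E v v 0
  | walk_cons : forall u w v n, E u w -> walk E w v n -> walk E u v (S n).

Definition connected {V : Type} (E : V -> V -> Prop) : Prop :=
  forall u v, exists n, walk E u v n.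

Definition infinite_type (V : Type) : Prop :=
  exists f : nat -> V, forall i j, f i = f j -> i = j.

Definition max_degree_3 {V : Type} (E : V -> V -> Prop) : Prop :=
  (forall v, exists l : list V, (length l <= 3)%nat /\ forall w, E v w -> In w l) /\
  (exists v, exists l : list V, length l = 3%nat /\ NoDup l /\ Forall (E v) l).

Definition graph_dist {V : Type} (E : V -> V -> Prop) (u v : V) (n : nat) : Prop :=
  walk E u v n /\ forall m, walk E u v m -> (n <= m)%nat.

Definition bilip_embed {V : Type} (E : V -> V -> Prop) (X : NormedSpace) : Prop :=
  exists (f : V -> X) (r C : R), 0 < r /\
    forall u v n, graph_dist E u v n ->
      r * INR n <= ns_norm (ns_sub (f u) (f v)) <= r * C * INR n.

(* Main.v *)
(* The graph H is built from finite sets A_p in the spaces X_n, rescaled and put far apart: each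
   point becomes a ray of vertices, so that any two points can be joined by a path of length
   comparable to their distance without exceeding degree 3.

   From H to linear embeddings: a bilipschitz map f on a large finite piece of a fine lattice in
   X_n is averaged over boxes. Averaging can only decrease the total variation
   sum_v |f(x+v) - f(x)| over a finite set of vectors v; by pigeonhole on the number of averaging
   steps some average has, at some point, all its increments almost as long as those of f. The
   averages telescope, so their second differences are small, and the increments at that point
   define a linear embedding of X_n of controlled distortion, whatever the target space.

   From linear embeddings to H: by Riesz' lemma X contains unit vectors u_0, u_1, ... with u_r
   uniformly transversal to the finite-dimensional span of u_q (q < r) and of the images of
   A_p (p <= r). They serve as private directions separating the copies A_p from each other and
   lifting each ray and each connecting path off the rest of the graph. *)
Require Import Defs.
From Stdlib Require Import Reals Lra Lia List ZArith Classical ClassicalEpsilon.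
From Stdlib Require Cantor.
Open Scope R_scope.

Notation "x +v y" := (ns_add x y) (at level 50, left associativity).
Notation "x -v y" := (ns_sub x y) (at level 50, left associativity).
Notation "a *v x" := (ns_scal a x) (at level 40, left associativity).
Notation "‖ x ‖" := (ns_norm x) (at level 10, x at level 99, format "‖ x ‖").

(** The distortion of an embedding of the graph is not known when the graph is built, so the copies
    are indexed by pairs (n, d): the copy whose number codes (n, d) tests [Xs n] against all maps of
    distortion at most d + 1 into all normed spaces. The linear map obtained has distortion at most
    6 (d + 1) for every n, which is the uniformity in (b). As the target is arbitrary, no
    differentiation theorem for Lipschitz maps can be used; a finite count replaces it.

    Conversely, the images of the spaces in X may overlap in any way. Since the dimensions are
    unbounded, X is infinite-dimensional and always has a further transversal direction.
    Transversality is one-sided: [u r] is far only from what precedes it. Lower estimates therefore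
    remove the direction of highest index first, each time at the price of a factor 3; a difference
    of two vertices involves boundedly many directions, so the constants are absolute up to [/ c].
    The rescaling makes distances inside a copy exceed the indices of the points; this pays for
    walking along a ray to the vertex where the right path starts. *)

Lemma scal_0_l {X : NormedSpace} (x : X) : 0 *v x = ns_zero.
Proof.
  apply ns_norm_eq0. rewrite ns_norm_scal, Rabs_R0. ring.
Qed.

Lemma scal_0_r {X : NormedSpace} (a : R) : a *v (ns_zero : X) = ns_zero.
Proof.
  rewrite <- (scal_0_l (ns_zero : X)), ns_scal_assoc. f_equal; ring.
Qed.

Lemma add_0_r {X : NormedSpace} (x : X) : x +v ns_zero = x.
Proof. now rewrite ns_add_comm, ns_add_0. Qed.

Lemma opp_scal {X : NormedSpace} (x : X) : ns_opp x = (-1) *v x.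
Proof.
  rewrite <- (ns_add_0 _ (ns_opp x)), <- (ns_add_0 _ ((-1) *v x)).
  assert (E : x +v ((-1) *v x) = ns_zero).
  { rewrite <- (ns_scal_1 _ x) at 1. rewrite <- ns_scal_distr_r.
    replace (1 + -1) with 0 by ring. apply scal_0_l. }
  rewrite <- E at 1. rewrite <- ns_add_assoc, (ns_add_comm _ ((-1) *v x)), ns_add_assoc.
  now rewrite ns_add_opp.
Qed.

(** * Vector identities by reflection *)

Inductive vexp : Type :=
  | VZero | VVar (n : nat) | VAdd (a b : vexp) | VSub (a b : vexp) | VOpp (a : vexp)
  | VScal (c : R) (a : vexp).

Fixpoint vden {X : NormedSpace} (env : list X) (e : vexp) : X :=
  match e with
  | VZero => ns_zero
  | VVar n => nth n env ns_zero
  | VAdd a b => vden env a +v vden env b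
  | VSub a b => vden env a -v vden env b
  | VOpp a => ns_opp (vden env a)
  | VScal c a => c *v vden env a
  end.

Fixpoint vcoef (e : vexp) (n : nat) : R :=
  match e with
  | VZero => 0
  | VVar m => if Nat.eqb m n then 1 else 0
  | VAdd a b => vcoef a n + vcoef b n
  | VSub a b => vcoef a n - vcoef b n
  | VOpp a => - vcoef a n
  | VScal c a => c * vcoef a n
  end.

Fixpoint vcomb {X : NormedSpace} (env : list X) (k : nat) (c : nat -> R) : X :=
  match env with
  | nil => ns_zero
  | v :: env' => c k *v v +v vcomb env' (S k) c
  end.

Lemma add_swap {X : NormedSpace} (a b c d : X) : (a +v b) +v (c +v d) = (a +v c) +v (b +v d).
Proof.
  rewrite <- !ns_add_assoc. f_equal. rewrite !ns_add_assoc. f_equal. apply ns_add_comm.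
Qed.

Lemma vcomb_add {X : NormedSpace} (env : list X) k c d :
  vcomb env k (fun n => c n + d n) = vcomb env k c +v vcomb env k d.
Proof.
  revert k; induction env as [|v env IH]; intro k; simpl.
  - now rewrite ns_add_0.
  - now rewrite IH, ns_scal_distr_r, add_swap.
Qed.

Lemma vcomb_scal {X : NormedSpace} (env : list X) k a c :
  vcomb env k (fun n => a * c n) = a *v vcomb env k c.
Proof.
  revert k; induction env as [|v env IH]; intro k; simpl.
  - now rewrite scal_0_r.
  - now rewrite IH, ns_scal_distr_l, ns_scal_assoc.
Qed.

Lemma vcomb_ext {X : NormedSpace} (env : list X) k c d :
  (forall n, (n < k + length env)%nat -> c n = d n) -> vcomb env k c = vcomb env k d.
Proof.
  revert k; induction env as [|v env IH]; intros k H; simpl in *; trivial.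
  f_equal. now rewrite H by lia. apply IH; intros; apply H; lia.
Qed.

Lemma vcomb_zero {X : NormedSpace} (env : list X) k c :
  (forall n, (k <= n)%nat -> c n = 0) -> vcomb env k c = ns_zero.
Proof.
  revert k; induction env as [|v env IH]; intros k H; simpl; trivial.
  rewrite H, scal_0_l, ns_add_0 by lia. apply IH; intros; apply H; lia.
Qed.

Lemma vcomb_var {X : NormedSpace} (env : list X) m k :
  vcomb env k (fun n => if Nat.eqb (k + m) n then 1 else 0) = nth m env ns_zero.
Proof.
  revert m k; induction env as [|v env IH]; intros [|m] k; simpl; trivial.
  - rewrite Nat.add_0_r, Nat.eqb_refl, ns_scal_1, vcomb_zero, add_0_r; trivial.
    intros n Hn. destruct (Nat.eqb_spec k n); [lia|trivial].
  - destruct (Nat.eqb_spec (k + S m) k); [lia|]. rewrite scal_0_l, ns_add_0, <- (IH m (S k)).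
    now rewrite Nat.add_succ_r.
Qed.

Lemma vden_norm {X : NormedSpace} (env : list X) e : vden env e = vcomb env 0 (vcoef e).
Proof.
  induction e; simpl.
  - now rewrite vcomb_zero.
  - symmetry. apply (vcomb_var env n 0).
  - rewrite IHe1, IHe2. symmetry. apply vcomb_add.
  - unfold ns_sub. rewrite opp_scal, IHe1, IHe2, <- vcomb_scal, <- vcomb_add.
    apply vcomb_ext; intros; ring.
  - rewrite opp_scal, IHe, <- vcomb_scal. apply vcomb_ext; intros; ring.
  - rewrite IHe. symmetry. apply vcomb_scal.
Qed.

(** A conjunction instead of a quantifier over [n], so that [cbn] turns it into one closed real
    equation per atom. *)
Fixpoint vagree (k : nat) (a b : vexp) : Prop :=
  match k with
  | O => True
  | S k' => vcoef a k' = vcoef b k' /\ vagree k' a b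
  end.

Lemma vexp_eq {X : NormedSpace} (env : list X) a b :
  vagree (length env) a b -> vden env a = vden env b.
Proof.
  intro H. rewrite !vden_norm. apply vcomb_ext. simpl.
  induction (length env) as [|k IH]; intros n Hn; [lia|]. destruct H as [H1 H2].
  destruct (Nat.eq_dec n k) as [->|]; [trivial|]. apply IH; trivial; lia.
Qed.

Ltac vlookup x env :=
  lazymatch env with
  | x :: _ => constr:(O)
  | _ :: ?env' => let n := vlookup x env' in constr:(S n)
  end.
Ltac vmember x env :=
  lazymatch env with
  | nil => constr:(false)
  | x :: _ => constr:(true)
  | _ :: ?env' => vmember x env'
  end.
Ltac vatoms env t :=
  lazymatch t with
  | ns_zero => env
  | ns_add ?a ?b => let env1 := vatoms env a in vatoms env1 b
  | ns_sub ?a ?b => let env1 := vatoms env a in vatoms env1 b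
  | ns_opp ?a => vatoms env a
  | ns_scal _ ?a => vatoms env a
  | _ => let m := vmember t env in
         lazymatch m with true => env | false => constr:(t :: env) end
  end.
Ltac vreify env t :=
  lazymatch t with
  | ns_zero => constr:(VZero)
  | ns_add ?a ?b => let a' := vreify env a in let b' := vreify env b in constr:(VAdd a' b')
  | ns_sub ?a ?b => let a' := vreify env a in let b' := vreify env b in constr:(VSub a' b')
  | ns_opp ?a => let a' := vreify env a in constr:(VOpp a')
  | ns_scal ?c ?a => let a' := vreify env a in constr:(VScal c a')
  | _ => let n := vlookup t env in constr:(VVar n)
  end.
(* Reduces an identity between vectors to the equality of the coefficients of each atom. *)
Ltac vred :=
  lazymatch goal with
  | |- @eq (ns_car ?X) ?l ?r =>
      let env0 := vatoms (@nil (ns_car X)) l in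
      let env := vatoms env0 r in
      let l' := vreify env l in
      let r' := vreify env r in
      change (vden env l' = vden env r'); apply vexp_eq;
      cbn [vagree length vcoef Nat.eqb]; repeat split
  end.
Ltac vring := vred; try ring; try lra.
Ltac vfield := vred; try (field; auto).

Lemma norm_0 {X : NormedSpace} : ‖(ns_zero : X)‖ = 0.
Proof. rewrite <- (scal_0_l (ns_zero : X)), ns_norm_scal, Rabs_R0. ring. Qed.

Lemma norm_opp {X : NormedSpace} (x : X) : ‖ns_opp x‖ = ‖x‖.
Proof. rewrite opp_scal, ns_norm_scal, Rabs_left by lra. ring. Qed.

Lemma norm_sub_sym {X : NormedSpace} (x y : X) : ‖x -v y‖ = ‖y -v x‖.
Proof. rewrite <- norm_opp. f_equal. vring. Qed.

Lemma norm_sub_le {X : NormedSpace} (x y : X) : ‖x -v y‖ <= ‖x‖ + ‖y‖.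
Proof. unfold ns_sub. rewrite <- (norm_opp y). apply ns_norm_triangle. Qed.

Lemma norm_le_of_eq {X : NormedSpace} (x y z : X) : x = y +v z -> ‖x‖ <= ‖y‖ + ‖z‖.
Proof. intros ->. apply ns_norm_triangle. Qed.

Lemma norm_sub_0 {X : NormedSpace} (x : X) : ‖x -v x‖ = 0.
Proof. replace (x -v x) with (ns_zero : X) by vring. apply norm_0. Qed.

(** * Finite-dimensional subspaces *)

(** Combinations of [L] with coefficients in [P], up to a remainder in [W]. The one predicate covers
    spans, spans modulo a subspace, lattice points, and vectors with bounded coordinates. *)
Fixpoint comb {X : NormedSpace} (P : R -> Prop) (W : X -> Prop) (L : list X) (x : X) : Prop :=
  match L with
  | nil => W x
  | u :: L' => exists a y, P a /\ comb P W L' y /\ x = a *v u +v y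
  end.

Definition is_zero {X : NormedSpace} (x : X) : Prop := x = ns_zero.
Definition span_mod {X : NormedSpace} (W : X -> Prop) (L : list X) : X -> Prop :=
  comb (fun _ => True) W L.
Definition span {X : NormedSpace} (L : list X) : X -> Prop := span_mod is_zero L.

Lemma comb_weaken {X : NormedSpace} (P P' : R -> Prop) (W W' : X -> Prop) L x :
  (forall a, P a -> P' a) -> (forall y, W y -> W' y) -> comb P W L x -> comb P' W' L x.
Proof.
  intros HP HW. revert x; induction L as [|u L IH]; intros x; simpl; auto.
  intros (a & y & Ha & Hy & ->). exists a, y; auto.
Qed.

Lemma subspace_zero {X : NormedSpace} : is_subspace (@is_zero X).
Proof.
  unfold is_zero. repeat split.
  - intros x y -> ->. vring.
  - intros a x ->. vring.
Qed.

Lemma subspace_sub {X : NormedSpace} (W : X -> Prop) x y :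
  is_subspace W -> W x -> W y -> W (x -v y).
Proof.
  intros (H0 & Ha & Hs) Hx Hy. replace (x -v y) with (x +v (-1) *v y) by vring. auto.
Qed.

Lemma subspace_lin {X : NormedSpace} (W : X -> Prop) a x y :
  is_subspace W -> W x -> W y -> W (a *v x +v y).
Proof. intros (H0 & Ha & Hs) Hx Hy. auto. Qed.

Lemma subspace_span_mod {X : NormedSpace} (W : X -> Prop) L :
  is_subspace W -> is_subspace (span_mod W L).
Proof.
  intros HW. induction L as [|u L (H0 & Ha & Hs)]; [exact HW|].
  split; [|split].
  - exists 0, ns_zero. repeat split; trivial. vring.
  - intros x y (a & x' & _ & Hx & ->) (b & y' & _ & Hy & ->).
    exists (a + b), (x' +v y'). repeat split; [apply Ha; auto|vring].
  - intros c x (a & x' & _ & Hx & ->).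
    exists (c * a), (c *v x'). repeat split; [apply Hs; auto|vring].
Qed.

Lemma subspace_span {X : NormedSpace} (L : list X) : is_subspace (span L).
Proof. apply subspace_span_mod, subspace_zero. Qed.

Lemma span_mod_base {X : NormedSpace} (W : X -> Prop) L x : W x -> span_mod W L x.
Proof.
  intro Hx. induction L as [|u L IH]; [exact Hx|].
  exists 0, x. repeat split; trivial. vring.
Qed.

Lemma span_mod_cons {X : NormedSpace} (W : X -> Prop) u L x :
  span_mod W L x -> span_mod W (u :: L) x.
Proof. intro Hx. exists 0, x. repeat split; trivial. vring. Qed.

Lemma span_mod_in {X : NormedSpace} (W : X -> Prop) L x :
  is_subspace W -> In x L -> span_mod W L x.
Proof.
  intros HW. induction L as [|u L IH]; [intros []|intros [->|Hx]].
  - exists 1, ns_zero. repeat split; [|vring]. apply (subspace_span_mod W L HW).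
  - apply span_mod_cons; auto.
Qed.

Lemma span_min {X : NormedSpace} (W : X -> Prop) L :
  is_subspace W -> Forall W L -> forall x, span L x -> W x.
Proof.
  intros HW HL. induction HL as [|u L Hu HL IH]; intros x Hx.
  - rewrite Hx. apply HW.
  - destruct Hx as (a & y & _ & Hy & ->). apply subspace_lin; auto.
Qed.

Lemma span_lincomb {X : NormedSpace} (L : list X) x :
  span L x <-> exists cs, length cs = length L /\ x = lincomb (combine cs L).
Proof.
  revert x; induction L as [|u L IH]; intro x; split.
  - intros Hx. exists nil. split; trivial.
  - intros ([|c cs] & Hl & ->); [reflexivity|discriminate].
  - intros (a & y & _ & Hy & ->). apply IH in Hy. destruct Hy as (cs & Hl & ->).
    exists (a :: cs). split; [simpl; now rewrite Hl|reflexivity].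
  - intros ([|c cs] & Hl & ->); [discriminate|].
    exists c, (lincomb (combine cs L)). repeat split. apply IH. exists cs. split; trivial.
    now injection Hl.
Qed.

(** * Closedness and the lemma of Riesz *)

Definition closed_set {X : NormedSpace} (W : X -> Prop) : Prop :=
  forall v, ~ W v -> exists d, 0 < d /\ forall y, W y -> d <= ‖v -v y‖.

(** The infimum is taken as minus a supremum, since [completeness] speaks of least upper bounds. *)
Lemma dist_exists {X : NormedSpace} (W : X -> Prop) :
  W ns_zero -> exists d : X -> R, forall v, 0 <= d v /\ (forall y, W y -> d v <= ‖v -v y‖) /\
    (forall eps, 0 < eps -> exists y, W y /\ ‖v -v y‖ < d v + eps).
Proof.
  intro H0. apply (choice (fun v d => 0 <= d /\ (forall y, W y -> d <= ‖v -v y‖) /\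
    (forall eps, 0 < eps -> exists y, W y /\ ‖v -v y‖ < d + eps))). intro v.
  destruct (completeness (fun r => exists y, W y /\ r = - ‖v -v y‖)) as (m & Hu & Hl).
  - exists 0. intros r (y & _ & ->). pose proof (ns_norm_nonneg _ (v -v y)). lra.
  - exists (- ‖v -v ns_zero‖), ns_zero. auto.
  - exists (- m). repeat split.
    + assert (m <= 0); [|lra]. apply Hl. intros r (y & _ & ->).
      pose proof (ns_norm_nonneg _ (v -v y)). lra.
    + intros y Hy. assert (- ‖v -v y‖ <= m) by (apply Hu; eauto). lra.
    + intros eps He. apply NNPP. intro Hn. assert (m <= m - eps); [|lra].
      apply Hl. intros r (y & Hy & ->). apply Rnot_lt_le. intro Hlt. apply Hn.
      exists y. split; trivial. lra.
Qed.

Lemma closed_zero {X : NormedSpace} : closed_set (@is_zero X).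
Proof.
  intros v Hv. exists (‖v‖). split.
  - destruct (ns_norm_nonneg _ v) as [H|H]; trivial. exfalso. apply Hv. now apply ns_norm_eq0.
  - intros y ->. right. f_equal. vring.
Qed.

Lemma closed_dist_pos {X : NormedSpace} (W : X -> Prop) (d : X -> R) v :
  closed_set W -> (forall eps, 0 < eps -> exists y, W y /\ ‖v -v y‖ < d v + eps) ->
  ~ W v -> 0 < d v.
Proof.
  intros HW Hd Hv. destruct (HW v Hv) as (e & He & Hle).
  destruct (Hd (e / 2)) as (y & Hy & Hlt); [lra|]. specialize (Hle y Hy). lra.
Qed.

(* The distance from [v - a e] to [W] is continuous and positive in [a], and only
   a compact interval of values of [a] matters. *)
Lemma closed_span_one {X : NormedSpace} (W : X -> Prop) (e : X) :
  is_subspace W -> closed_set W -> closed_set (span_mod W (e :: nil)).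
Proof.
  intros HW Hcl v Hv.
  destruct (dist_exists W (proj1 HW)) as (d & Hd).
  assert (Hva : forall a, ~ W (v -v a *v e)).
  { intros a Ha. apply Hv. exists a, (v -v a *v e). repeat split; trivial. vring. }
  assert (Hpos : forall a, 0 < d (v -v a *v e)).
  { intro a. apply (closed_dist_pos W); auto. apply Hd. }
  destruct (classic (W e)) as [He|He].
  { exists (d v). split.
    - replace v with (v -v 0 *v e) by vring. apply Hpos.
    - intros y (a & y' & _ & Hy & ->). apply Hd. simpl in Hy. apply subspace_lin; auto. }
  assert (Hde : 0 < d e) by (apply (closed_dist_pos W); auto; apply Hd).
  set (h := fun a => d (v -v a *v e)).
  assert (Hlip : forall a b, h a <= h b + Rabs (a - b) * ‖e‖).
  { intros a b. apply le_epsilon. intros eps Heps. unfold h.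
    destruct (Hd (v -v b *v e)) as (_ & _ & Hb). destruct (Hb eps Heps) as (y & Hy & Hlt).
    pose proof (proj1 (proj2 (Hd (v -v a *v e))) y Hy) as Ha.
    assert (‖v -v a *v e -v y‖ <= ‖v -v b *v e -v y‖ + ‖(b - a) *v e‖)
      by (apply norm_le_of_eq; vring).
    rewrite ns_norm_scal, Rabs_minus_sym in H. lra. }
  (* If [‖v - (a e + y')‖ < 1] with [y'] in [W], then [|a| d(e) <= ‖a e + y'‖ <= ‖v‖ + 1]. So for
     [a] outside [[-r, r]] the distance is at least 1. *)
  set (r := (‖v‖ + 1) / d e).
  assert (Hr : 0 < r).
  { apply Rdiv_lt_0_compat; trivial. pose proof (ns_norm_nonneg _ v). lra. }
  destruct (continuity_ab_min h (- r) r) as (m & Hm & _); [lra| |].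
  { intros c _ eps Heps. pose proof (ns_norm_nonneg _ e) as Hn.
    exists (eps / (‖e‖ + 1)). split; [apply Rdiv_lt_0_compat; lra|].
    intros x (_ & Hx). simpl in *. unfold Rdist in *.
    assert (Rabs (x - c) * (‖e‖ + 1) < eps).
    { apply Rmult_lt_reg_r with (/ (‖e‖ + 1)); [apply Rinv_0_lt_compat; lra|].
      rewrite Rmult_assoc, Rinv_r by lra. rewrite Rmult_1_r. exact Hx. }
    pose proof (Hlip x c) as H1. pose proof (Hlip c x) as H2. rewrite Rabs_minus_sym in H2.
    pose proof (Rabs_pos (x - c)).
    assert (Rabs (x - c) * (‖e‖ + 1) = Rabs (x - c) * ‖e‖ + Rabs (x - c)) by ring.
    destruct (Req_dec (Rabs (x - c)) 0) as [H5|H5].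
    - rewrite H5 in *. apply Rabs_def1; lra.
    - apply Rabs_def1; lra. }
  exists (Rmin 1 (h m)). split; [apply Rmin_pos; [lra|apply Hpos]|].
  intros y (a & y' & _ & Hy & ->). simpl in Hy.
  destruct (Rle_lt_dec 1 (‖v -v (a *v e +v y')‖)) as [H1|H1].
  { eapply Rle_trans; [apply Rmin_l|exact H1]. }
  eapply Rle_trans; [apply Rmin_r|].
  assert (Ha : Rabs a <= r).
  { assert (Rabs a * d e <= ‖v‖ + 1).
    { destruct (Req_dec a 0) as [->|Ha].
      - rewrite Rabs_R0, Rmult_0_l. pose proof (ns_norm_nonneg _ v). lra.
      - assert (H : d e <= ‖e -v (- / a) *v y'‖).
        { apply Hd. apply HW. exact Hy. }
        apply Rmult_le_compat_l with (r := Rabs a) in H; [|apply Rabs_pos].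
        rewrite <- ns_norm_scal in H. eapply Rle_trans; [exact H|].
        assert (‖a *v (e -v (- / a) *v y')‖ <= ‖v‖ + ‖ns_opp (v -v (a *v e +v y'))‖).
        { apply norm_le_of_eq. vfield. }
        rewrite norm_opp in H0. lra. }
    unfold r. apply Rmult_le_reg_r with (d e); trivial.
    unfold Rdiv. rewrite Rmult_assoc, Rinv_l by lra. lra. }
  apply Rle_trans with (h a).
  - apply Hm. pose proof (Rle_abs a). pose proof (Rle_abs (- a)). rewrite Rabs_Ropp in H0. lra.
  - replace (v -v (a *v e +v y')) with (v -v a *v e -v y') by vring.
    apply (proj1 (proj2 (Hd (v -v a *v e)))). exact Hy.
Qed.

Lemma closed_span {X : NormedSpace} (L : list X) : closed_set (span L).
Proof.
  induction L as [|u L IH].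
  - apply closed_zero.
  - apply (closed_span_one (span L)); trivial. apply subspace_span.
Qed.

(** Take [y0] in the span within a factor 2 of the distance from [v], and normalize [v - y0]. No
    nearest point is needed, and the factor 2 is the [1/2] of the conclusion. *)
Lemma riesz {X : NormedSpace} (L : list X) v :
  ~ span L v -> exists u, ‖u‖ = 1 /\ forall y a, span L y -> Rabs a / 2 <= ‖y +v a *v u‖.
Proof.
  intro Hv. pose proof (subspace_span L) as HL.
  destruct (dist_exists (span L) (proj1 HL)) as (d & Hd).
  assert (Hp : 0 < d v) by (apply (closed_dist_pos (span L)); trivial; [apply closed_span|apply Hd]).
  destruct (proj2 (proj2 (Hd v)) (d v) Hp) as (y0 & Hy0 & Hlt).
  pose proof (proj1 (proj2 (Hd v)) y0 Hy0) as Hge.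
  set (n := ‖v -v y0‖) in *.
  exists (/ n *v (v -v y0)). split.
  - rewrite ns_norm_scal, Rabs_pos_eq; [apply Rinv_l; unfold n in *; lra|].
    left. apply Rinv_0_lt_compat. lra.
  - intros y a Hy. destruct (Req_dec a 0) as [->|Ha].
    { rewrite Rabs_R0. pose proof (ns_norm_nonneg _ (y +v 0 *v (/ n *v (v -v y0)))). lra. }
    replace (y +v a *v (/ n *v (v -v y0)))
      with ((a / n) *v (v -v (y0 -v (n / a) *v y))) by (vfield; split; trivial; lra).
    rewrite ns_norm_scal.
    assert (H : d v <= ‖v -v (y0 -v (n / a) *v y)‖).
    { apply Hd. apply subspace_sub; trivial. apply HL. exact Hy. }
    unfold Rdiv at 2. rewrite Rabs_mult, (Rabs_pos_eq (/ n)) by (left; apply Rinv_0_lt_compat; lra).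
    assert (/ 2 <= / n * ‖v -v (y0 -v n / a *v y)‖).
    { apply Rmult_le_reg_l with n; [lra|]. rewrite <- Rmult_assoc, Rinv_r by lra. lra. }
    pose proof (Rabs_pos a). unfold Rdiv at 1. rewrite Rmult_assoc. apply Rmult_le_compat_l; trivial.
Qed.

(** * Independence and exchange modulo a subspace *)

Definition indep_mod {X : NormedSpace} (W : X -> Prop) (vs : list X) : Prop :=
  forall cs, length cs = length vs -> W (lincomb (combine cs vs)) -> Forall (fun c => c = 0) cs.

Lemma lincomb_zeros {X : NormedSpace} (vs : list X) k :
  lincomb (combine (repeat 0 k) vs) = ns_zero.
Proof.
  revert k; induction vs as [|v vs IH]; intros [|k]; simpl; trivial.
  rewrite IH. vring.
Qed.

Lemma indep_mod_cons {X : NormedSpace} (W : X -> Prop) v vs :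
  is_subspace W -> indep_mod W (v :: vs) -> ~ W v /\ indep_mod (span_mod W (v :: nil)) vs.
Proof.
  intros HW H. split.
  - intro Hv. specialize (H (1 :: repeat 0 (length vs))). simpl in H.
    rewrite repeat_length, lincomb_zeros in H. specialize (H eq_refl).
    assert (Hf : W (1 *v v +v ns_zero)) by (replace (1 *v v +v ns_zero) with v by vring; trivial).
    apply H in Hf. inversion Hf. lra.
  - intros cs Hl (a & y & _ & Hy & E). simpl in Hy.
    assert (Hf : Forall (fun c => c = 0) ((- a) :: cs)).
    { apply H; [simpl; now rewrite Hl|]. simpl. rewrite E.
      replace (- a *v v +v (a *v v +v y)) with y by vring. trivial. }
    now inversion Hf.
Qed.

Lemma exchange {X : NormedSpace} (W : X -> Prop) L v :
  is_subspace W -> span_mod W L v -> ~ W v ->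
  exists L', length L = S (length L') /\
    forall x, span_mod W L x -> span_mod (span_mod W (v :: nil)) L' x.
Proof.
  intros HW. induction L as [|u L IH]; intros Hv HnW; [now elim HnW|].
  destruct Hv as (a & y & _ & Hy & E). fold (@span_mod X W) in Hy.
  assert (HW' : is_subspace (span_mod W (v :: nil))) by (now apply subspace_span_mod).
  assert (Hmono : forall x, span_mod W L x -> span_mod (span_mod W (v :: nil)) L x).
  { intros x. apply comb_weaken; trivial. intros z Hz. apply (span_mod_cons W v nil). exact Hz. }
  destruct (Req_dec a 0) as [->|Ha].
  - assert (E' : v = y) by (rewrite E; vring). rewrite <- E' in Hy.
    destruct (IH Hy HnW) as (L' & Hl & HL'). exists (u :: L'). split; [simpl; now rewrite Hl|].
    intros x (b & z & _ & Hz & ->). exists b, z. repeat split. now apply HL'.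
  - exists L. split; trivial. intros x (b & z & _ & Hz & ->).
    replace (b *v u +v z) with ((b / a) *v v +v ((- (b / a)) *v y +v z)) by (rewrite E; vfield).
    pose proof (subspace_span_mod (span_mod W (v :: nil)) L HW') as HS.
    apply subspace_lin; trivial.
    + apply span_mod_base. exists 1, ns_zero. repeat split; [apply HW|vring].
    + apply subspace_lin; auto.
Qed.

(** Induction on [vs] with [W] growing: each independent vector is absorbed into [W], and by
    [exchange] this shortens [L] by one. *)
Lemma steinitz {X : NormedSpace} (vs : list X) : forall (W : X -> Prop) L,
  is_subspace W -> indep_mod W vs -> Forall (span_mod W L) vs -> (length vs <= length L)%nat.
Proof.
  induction vs as [|v vs IH]; intros W L HW Hi Hs; simpl; [lia|].
  destruct (indep_mod_cons W v vs HW Hi) as (Hv & Hi').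
  inversion Hs as [|? ? Hsv Hsvs]; subst.
  destruct (exchange W L v HW Hsv Hv) as (L' & -> & HL').
  apply le_n_S, (IH (span_mod W (v :: nil))); trivial.
  - now apply subspace_span_mod.
  - eapply Forall_impl; [|exact Hsvs]. exact HL'.
Qed.

Lemma exists_outside_span {X : NormedSpace} (L : list X) :
  (forall k, dim_ge (fun _ : X => True) k) -> exists v, ~ span L v.
Proof.
  intros H. apply NNPP. intro Hn. destruct (H (S (length L))) as (vs & Hl & _ & Hi).
  assert (length vs <= length L)%nat; [|lia].
  apply (steinitz vs is_zero); trivial.
  - apply subspace_zero.
  - apply Forall_forall. intros v _. apply NNPP. intro Hv. apply Hn. now exists v.
Qed.

(** * Bases, coordinates and linear extension *)

(** Independence in triangular form: the condition on the head is exactly what [closed_span] needs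
    to bound its distance from the span of the tail. *)
Fixpoint chain_indep {X : NormedSpace} (es : list X) : Prop :=
  match es with
  | nil => True
  | e :: es' => ~ span es' e /\ chain_indep es'
  end.

Lemma basis_exists {X : NormedSpace} (S : X -> Prop) :
  is_subspace S -> finite_dim S ->
  exists es, chain_indep es /\ forall x, S x <-> span es x.
Proof.
  intros HS (vs & Hvs & Hsp).
  assert (exists es, chain_indep es /\ forall x, span es x <-> span vs x) as (es & Hi & He).
  { clear. induction vs as [|v vs (es & Hi & He)]; [exists nil; simpl; tauto|].
    destruct (classic (span es v)) as [Hv|Hv].
    - exists es. split; trivial. intro x. rewrite He. split; [apply span_mod_cons|].
      intros (a & y & _ & Hy & ->). apply subspace_lin; trivial; [apply subspace_span|].
      now apply He.
    - exists (v :: es). split; [split; trivial|]. intro x.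
      split; intros (a & y & _ & Hy & ->); exists a, y; repeat split; now apply He. }
  exists es. split; trivial. intro x. rewrite He. split.
  - intro Hx. apply span_lincomb. now apply Hsp.
  - now apply span_min.
Qed.

(** If [d] is the distance from [e] to the span of the other vectors, then [|a| d <= ‖a e + y'‖].
    This bounds the first coordinate and, by the triangle inequality, the norm of [y'], to which the
    induction applies. *)
Lemma indep_coef_bound {X : NormedSpace} (es : list X) :
  chain_indep es -> exists B, 0 <= B /\
    forall y, span es y -> comb (fun a => Rabs a <= B * ‖y‖) is_zero es y.
Proof.
  induction es as [|e es IH]; intro Hi.
  { exists 0. split; [lra|]. intros y Hy. exact Hy. }
  destruct Hi as (He & Hi). destruct (IH Hi) as (B & HB & HBy).
  destruct (closed_span es e He) as (d & Hd & Hde).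
  pose proof (ns_norm_nonneg _ e) as Hne.
  assert (H1d : 0 < / d) by (now apply Rinv_0_lt_compat).
  exists (/ d + B * (1 + / d * ‖e‖)).
  assert (H0 : 0 <= B * (1 + / d * ‖e‖)).
  { apply Rmult_le_pos; trivial. assert (0 <= / d * ‖e‖) by (apply Rmult_le_pos; lra). lra. }
  split; [lra|]. intros y (a & y' & _ & Hy & ->).
  set (n := ‖a *v e +v y'‖).
  assert (Hn : 0 <= n) by apply ns_norm_nonneg.
  assert (Ha : Rabs a <= / d * n).
  { destruct (Req_dec a 0) as [->|Ha].
    - rewrite Rabs_R0. apply Rmult_le_pos; lra.
    - assert (H : d <= ‖e -v (- / a) *v y'‖) by (apply Hde; apply subspace_span; exact Hy).
      apply Rmult_le_compat_l with (r := Rabs a) in H; [|apply Rabs_pos].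
      rewrite <- ns_norm_scal in H.
      replace (a *v (e -v (- / a) *v y')) with (a *v e +v y') in H by vfield.
      fold n in H. apply Rmult_le_reg_l with d; trivial.
      rewrite <- Rmult_assoc, Rinv_r by lra. lra. }
  exists a, y'. split; [|split; trivial].
  - assert (0 <= B * (1 + / d * ‖e‖) * n) by (apply Rmult_le_pos; trivial). lra.
  - eapply comb_weaken; [| |apply HBy; exact Hy]; trivial. intros b Hb.
    assert (Hy' : ‖y'‖ <= (1 + / d * ‖e‖) * n).
    { assert (‖y'‖ <= n + ‖(- a) *v e‖) by (apply norm_le_of_eq; vring).
      rewrite ns_norm_scal, Rabs_Ropp in H.
      assert (Rabs a * ‖e‖ <= / d * n * ‖e‖) by (apply Rmult_le_compat_r; trivial). lra. }
    apply Rmult_le_compat_l with (r := B) in Hy'; trivial.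
    assert (0 <= / d * n) by (apply Rmult_le_pos; lra). lra.
Qed.

(** [T] is a total function on [Z], but linear only on the span. The coordinate [c] along [e] is
    obtained by choice; its uniqueness, from independence, makes it linear. *)
Lemma linear_extension {Z X : NormedSpace} (es : list Z) (t : Z -> X) :
  chain_indep es -> exists T : Z -> X, linear_on (span es) T /\ forall e, In e es -> T e = t e.
Proof.
  induction es as [|e es IH]; intro Hi.
  { exists (fun _ => ns_zero). split; [split; intros; vring|intros ? []]. }
  destruct Hi as (He & Hi). destruct (IH Hi) as (T & (Ta & Ts) & HT).
  pose proof (subspace_span es) as HS.
  assert (Hc : exists c : Z -> R, forall y, span (e :: es) y -> span es (y -v c y *v e)).
  { apply (choice (fun y c => span (e :: es) y -> span es (y -v c *v e))). intro y.
    destruct (classic (span (e :: es) y)) as [(a & y' & _ & Hy & ->)|Hy].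
    - exists a. intros _. replace (a *v e +v y' -v a *v e) with y' by vring. exact Hy.
    - exists 0. tauto. }
  destruct Hc as (c & Hc).
  assert (Hu : forall y a, span (e :: es) y -> span es (y -v a *v e) -> c y = a).
  { intros y a Hy Ha. apply NNPP. intro Hne. apply He.
    replace e with (/ (c y - a) *v ((y -v a *v e) -v (y -v c y *v e))) by (vfield; lra).
    apply HS. apply subspace_sub; auto. }
  assert (HS' := subspace_span (e :: es)).
  exists (fun y => c y *v t e +v T (y -v c y *v e)). split; [split|].
  - intros x y Hx Hy.
    assert (E : c (x +v y) = c x + c y).
    { apply Hu; [now apply HS'|].
      replace (x +v y -v (c x + c y) *v e) with ((x -v c x *v e) +v (y -v c y *v e)) by vring.
      apply HS; auto. }
    rewrite E.
    replace (x +v y -v (c x + c y) *v e) with ((x -v c x *v e) +v (y -v c y *v e)) by vring.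
    rewrite Ta by auto. vring.
  - intros a x Hx _.
    assert (E : c (a *v x) = a * c x).
    { apply Hu; [now apply HS'|].
      replace (a *v x -v (a * c x) *v e) with (a *v (x -v c x *v e)) by vring. apply HS; auto. }
    rewrite E. replace (a *v x -v (a * c x) *v e) with (a *v (x -v c x *v e)) by vring.
    rewrite Ts; [vring|auto|]. apply HS; auto.
  - intros x [<-|Hx].
    + assert (E : c e = 1).
      { apply Hu; [apply span_mod_in; [apply subspace_zero|now left]|].
        replace (e -v 1 *v e) with (ns_zero : Z) by vring. apply HS. }
      rewrite E. replace (e -v 1 *v e) with (0 *v (ns_zero : Z)) by vring.
      rewrite Ts; [vring|apply HS|apply HS; apply HS].
    + assert (Hx' : span es x) by (apply span_mod_in; trivial; apply subspace_zero).
      assert (E : c x = 0).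
      { apply Hu; [now apply span_mod_cons|]. replace (x -v 0 *v e) with x by vring. trivial. }
      rewrite E. replace (x -v 0 *v e) with x by vring. rewrite <- (HT x Hx). vring.
Qed.

(** * Finite sums *)

Fixpoint rsum (n : nat) (f : nat -> R) : R :=
  match n with O => 0 | S k => rsum k f + f k end.
Fixpoint vsum {X : NormedSpace} (n : nat) (f : nat -> X) : X :=
  match n with O => ns_zero | S k => vsum k f +v f k end.
Fixpoint lsum {A : Type} (l : list A) (f : A -> R) : R :=
  match l with nil => 0 | a :: l' => f a + lsum l' f end.

Lemma rsum_ext n f g : (forall j, (j < n)%nat -> f j = g j) -> rsum n f = rsum n g.
Proof. induction n as [|n IH]; intro H; simpl; trivial. rewrite H, IH; auto. Qed.

Lemma rsum_le n f g : (forall j, (j < n)%nat -> f j <= g j) -> rsum n f <= rsum n g.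
Proof.
  induction n as [|n IH]; intro H; simpl; [lra|].
  assert (rsum n f <= rsum n g) by auto. specialize (H n (le_n _)). lra.
Qed.

Lemma rsum_const n c : rsum n (fun _ => c) = INR n * c.
Proof. induction n as [|n IH]; [simpl; ring|]. rewrite S_INR. simpl. rewrite IH. ring. Qed.

Lemma rsum_scal n c f : rsum n (fun j => c * f j) = c * rsum n f.
Proof. induction n as [|n IH]; simpl; [ring|]. rewrite IH. ring. Qed.

Lemma rsum_add n f g : rsum n (fun j => f j + g j) = rsum n f + rsum n g.
Proof. induction n as [|n IH]; simpl; [ring|]. rewrite IH. ring. Qed.

Lemma rsum_exchange m n (f : nat -> nat -> R) :
  rsum m (fun i => rsum n (f i)) = rsum n (fun j => rsum m (fun i => f i j)).
Proof.
  induction m as [|m IH]; simpl.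
  - rewrite rsum_const. ring.
  - rewrite IH. symmetry. apply rsum_add.
Qed.

Lemma vsum_ext {X : NormedSpace} n (f g : nat -> X) :
  (forall j, (j < n)%nat -> f j = g j) -> vsum n f = vsum n g.
Proof. induction n as [|n IH]; intro H; simpl; trivial. rewrite H, IH; auto. Qed.

Lemma vsum_norm {X : NormedSpace} n (f : nat -> X) : ‖vsum n f‖ <= rsum n (fun j => ‖f j‖).
Proof.
  induction n as [|n IH]; simpl; [rewrite norm_0; lra|].
  pose proof (ns_norm_triangle _ (vsum n f) (f n)). lra.
Qed.

Lemma vsum_sub {X : NormedSpace} n (f g : nat -> X) :
  vsum n (fun j => f j -v g j) = vsum n f -v vsum n g.
Proof. induction n as [|n IH]; simpl; [vring|]. rewrite IH. vring. Qed.

Lemma vsum_telescope {X : NormedSpace} n (f : nat -> X) :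
  vsum n (fun j => f (S j) -v f j) = f n -v f O.
Proof. induction n as [|n IH]; simpl; [vring|]. rewrite IH. vring. Qed.

Lemma vsum_const {X : NormedSpace} n (c : X) : vsum n (fun _ => c) = INR n *v c.
Proof. induction n as [|n IH]; [simpl; vring|]. rewrite S_INR. simpl. rewrite IH. vring. Qed.

Lemma lsum_le {A} (l : list A) f g : (forall a, In a l -> f a <= g a) -> lsum l f <= lsum l g.
Proof.
  induction l as [|a l IH]; simpl; intro H; [lra|].
  assert (f a <= g a) by auto. assert (lsum l f <= lsum l g) by auto. lra.
Qed.

Lemma lsum_le_gap {A} (l : list A) f g b c :
  (forall a, In a l -> f a <= g a) -> In b l -> f b + c <= g b -> lsum l f + c <= lsum l g.
Proof.
  induction l as [|a l IH]; simpl; [tauto|]. intros H [->|Hb] Hc.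
  - assert (lsum l f <= lsum l g) by (apply lsum_le; auto). lra.
  - assert (lsum l f + c <= lsum l g) by auto. assert (f a <= g a) by auto. lra.
Qed.

Lemma lsum_nonneg {A} (l : list A) f : (forall a, In a l -> 0 <= f a) -> 0 <= lsum l f.
Proof.
  induction l as [|a l IH]; simpl; intro H; [lra|].
  assert (0 <= f a) by auto. assert (0 <= lsum l f) by auto. lra.
Qed.

Lemma lsum_in_le {A} (l : list A) f b : (forall a, In a l -> 0 <= f a) -> In b l -> f b <= lsum l f.
Proof.
  induction l as [|a l IH]; simpl; [tauto|]. intros H [->|Hb].
  - assert (0 <= lsum l f) by (apply lsum_nonneg; auto). lra.
  - assert (f b <= lsum l f) by auto. assert (0 <= f a) by auto. lra.
Qed.

Lemma lsum_scal {A} (l : list A) c f : lsum l (fun a => c * f a) = c * lsum l f.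
Proof. induction l as [|a l IH]; simpl; [ring|]. rewrite IH. ring. Qed.

Lemma lsum_map {A B} (l : list A) (h : A -> B) f : lsum (map h l) f = lsum l (fun a => f (h a)).
Proof. induction l as [|a l IH]; simpl; [ring|]. now rewrite IH. Qed.

Lemma exists_nat_ge (r : R) : exists n : nat, r <= INR n.
Proof.
  destruct (INR_unbounded r) as (n & Hn). exists n. lra.
Qed.

(** * Averages over boxes spanned by a list of directions *)

(* [av J F f x] is the mean of [f] over the points [x + sum_(v in F) j_v v], [0 <= j_v < J]. *)
Fixpoint av {Z X : NormedSpace} (J : nat) (F : list Z) (f : Z -> X) (x : Z) : X :=
  match F with
  | nil => f x
  | v :: F' => / INR J *v vsum J (fun j => av J F' f (x +v INR j *v v))
  end.
Fixpoint rav {Z : NormedSpace} (J : nat) (F : list Z) (g : Z -> R) (x : Z) : R :=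
  match F with
  | nil => g x
  | v :: F' => / INR J * rsum J (fun j => rav J F' g (x +v INR j *v v))
  end.
(** Here [j] runs up to [J] included, although the averages stop at [J - 1]: telescoped differences
    also see the end point [x + J v]. *)
Fixpoint on_box {Z : NormedSpace} (J : nat) (F : list Z) (P : Z -> Prop) (x : Z) : Prop :=
  match F with
  | nil => P x
  | v :: F' => forall j, (j <= J)%nat -> on_box J F' P (x +v INR j *v v)
  end.

Lemma on_box_corner {Z : NormedSpace} J (v : Z) F P x : on_box J (v :: F) P x -> on_box J F P x.
Proof.
  intro H. specialize (H O (Nat.le_0_l J)). replace (x +v INR 0 *v v) with x in H; trivial.
  simpl. vring.
Qed.

Section Averages.
Context {Z : NormedSpace} (J : nat) (HJ : (1 <= J)%nat).

Let J_pos : 0 < INR J.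
Proof. apply lt_0_INR. lia. Qed.
Let J_inv : 0 <= / INR J.
Proof. left. apply Rinv_0_lt_compat, J_pos. Qed.

Lemma mean_ge f c : (forall j, (j < J)%nat -> c <= f j) -> c <= / INR J * rsum J f.
Proof.
  intro H. apply rsum_le in H. rewrite rsum_const in H.
  apply Rmult_le_compat_l with (r := / INR J) in H; trivial.
  rewrite <- Rmult_assoc, Rinv_l in H by lra. lra.
Qed.

Lemma mean_le f c : (forall j, (j < J)%nat -> f j <= c) -> / INR J * rsum J f <= c.
Proof.
  intro H. apply rsum_le in H. rewrite rsum_const in H.
  apply Rmult_le_compat_l with (r := / INR J) in H; trivial.
  rewrite <- Rmult_assoc, (Rinv_l (INR J)) in H by lra. lra.
Qed.

Lemma mean_norm {X : NormedSpace} (f : nat -> X) :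
  ‖/ INR J *v vsum J f‖ <= / INR J * rsum J (fun j => ‖f j‖).
Proof.
  rewrite ns_norm_scal, Rabs_pos_eq by trivial. apply Rmult_le_compat_l; trivial. apply vsum_norm.
Qed.

Lemma rav_le F (g h : Z -> R) x : on_box J F (fun y => g y <= h y) x -> rav J F g x <= rav J F h x.
Proof.
  revert x; induction F as [|v F IH]; intros x H; trivial. simpl.
  apply Rmult_le_compat_l; trivial. apply rsum_le. intros j Hj. apply IH, H. lia.
Qed.

Lemma rav_const F c (x : Z) : rav J F (fun _ => c) x = c.
Proof.
  revert x; induction F as [|v F IH]; intro x; trivial. simpl.
  rewrite (rsum_ext _ _ (fun _ => c)) by auto. rewrite rsum_const, <- Rmult_assoc, Rinv_l by lra. ring.
Qed.

Lemma rav_lsum {A} (l : list A) F (g : A -> Z -> R) x :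
  rav J F (fun y => lsum l (fun a => g a y)) x = lsum l (fun a => rav J F (g a) x).
Proof.
  revert x; induction F as [|v F IH]; intro x; trivial. simpl. rewrite lsum_scal. f_equal.
  rewrite (rsum_ext _ _ (fun j => lsum l (fun a => rav J F (g a) (x +v INR j *v v)))) by auto.
  clear. induction l as [|a l IHl]; simpl.
  - rewrite rsum_const. ring.
  - now rewrite rsum_add, IHl.
Qed.

Lemma rav_shift_sum F v (h : Z -> R) n x :
  rsum n (fun j => rav J F h (x +v INR j *v v)) =
  rav J F (fun y => rsum n (fun j => h (y +v INR j *v v))) x.
Proof.
  revert x; induction F as [|u F IH]; intro x; trivial. simpl.
  rewrite rsum_scal, rsum_exchange. f_equal. apply rsum_ext. intros i _.
  rewrite <- IH. apply rsum_ext. intros j _. f_equal. vring.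
Qed.

Lemma rav_scal F c (h : Z -> R) x : rav J F (fun y => c * h y) x = c * rav J F h x.
Proof.
  revert x; induction F as [|u F IH]; intro x; trivial. simpl.
  rewrite (rsum_ext _ _ (fun j => c * rav J F h (x +v INR j *v u))) by auto.
  rewrite rsum_scal. ring.
Qed.

(** Averages commute with translations, so the mean along [v] can be taken innermost; a lower bound
    for all means along [v] then passes to the whole average. *)
Lemma rav_ge_of_mean F v (h : Z -> R) c x : In v F ->
  on_box J F (fun y => c <= / INR J * rsum J (fun j => h (y +v INR j *v v))) x ->
  c <= rav J F h x.
Proof.
  revert x; induction F as [|u F IH]; intros x; [intros []|]. intros [->|Hv] H; simpl.
  - rewrite rav_shift_sum, <- rav_scal, <- (rav_const F c x).
    apply rav_le. now apply on_box_corner in H.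
  - apply mean_ge. intros j Hj. apply IH; trivial. apply H. lia.
Qed.

Lemma av_norm {X : NormedSpace} F (f : Z -> X) x : ‖av J F f x‖ <= rav J F (fun y => ‖f y‖) x.
Proof.
  revert x; induction F as [|v F IH]; intro x; simpl; [lra|].
  eapply Rle_trans; [apply mean_norm|]. apply Rmult_le_compat_l; trivial.
  apply rsum_le. auto.
Qed.

Lemma av_diff {X : NormedSpace} F (f : Z -> X) h x :
  av J F f (x +v h) -v av J F f x = av J F (fun y => f (y +v h) -v f y) x.
Proof.
  revert x; induction F as [|v F IH]; intro x; trivial. simpl.
  rewrite (vsum_ext J (fun j => av J F (fun y => f (y +v h) -v f y) (x +v INR j *v v))
    (fun j => av J F f (x +v INR j *v v +v h) -v av J F f (x +v INR j *v v))) by auto.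
  rewrite vsum_sub.
  rewrite (vsum_ext J (fun j => av J F f (x +v h +v INR j *v v))
    (fun j => av J F f (x +v INR j *v v +v h))); [vring|].
  intros j _. f_equal. vring.
Qed.

Lemma av_diff_norm {X : NormedSpace} F (f : Z -> X) h x :
  ‖av J F f (x +v h) -v av J F f x‖ <= rav J F (fun y => ‖f (y +v h) -v f y‖) x.
Proof. rewrite av_diff. apply av_norm. Qed.

Lemma av_diff_le {X : NormedSpace} F (f : Z -> X) h M x :
  on_box J F (fun y => ‖f (y +v h) -v f y‖ <= M) x -> ‖av J F f (x +v h) -v av J F f x‖ <= M.
Proof.
  intro H. eapply Rle_trans; [apply av_diff_norm|].
  rewrite <- (rav_const F M x). now apply rav_le.
Qed.

(* The mean over the multiples of [u] telescopes when differenced along [u]. *)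
Lemma av_second_diff {X : NormedSpace} F (f : Z -> X) u h M x : In u F ->
  on_box J F (fun y => ‖f (y +v h) -v f y‖ <= M) x ->
  ‖(av J F f (x +v u +v h) -v av J F f (x +v u)) -v (av J F f (x +v h) -v av J F f x)‖
    <= 2 * M / INR J.
Proof.
  revert x; induction F as [|v F IH]; intros x; [intros []|].
  set (G := av J F f). intros [->|Hu] H; cbn [av]; fold G.
  - assert (T : forall y, / INR J *v vsum J (fun j => G (y +v u +v INR j *v u)) -v
      / INR J *v vsum J (fun j => G (y +v INR j *v u)) = / INR J *v (G (y +v INR J *v u) -v G y)).
    { intro y. set (g := fun i => G (y +v INR i *v u)).
      transitivity (/ INR J *v vsum J (fun j => g (S j) -v g j)).
      - unfold g. rewrite vsum_sub. rewrite (vsum_ext J (fun j => G (y +v u +v INR j *v u))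
          (fun j => G (y +v INR (S j) *v u))); [vring|].
        intros j _. rewrite S_INR. f_equal. vring.
      - rewrite (vsum_telescope J g). unfold g. do 3 f_equal. simpl. vring. }
    assert (E : forall a b c d : X, (a -v b) -v (c -v d) = (a -v c) -v (b -v d)) by (intros; vring).
    rewrite E, T.
    rewrite (vsum_ext J (fun j => G (x +v u +v h +v INR j *v u))
      (fun j => G ((x +v h) +v u +v INR j *v u))) by (intros; f_equal; vring).
    rewrite T.
    replace (/ INR J *v (G (x +v h +v INR J *v u) -v G (x +v h)) -v
       / INR J *v (G (x +v INR J *v u) -v G x)) with
      (/ INR J *v ((G (x +v INR J *v u +v h) -v G (x +v INR J *v u)) -v (G (x +v h) -v G x)))
      by (replace (x +v INR J *v u +v h) with (x +v h +v INR J *v u) by vring; vring).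
    assert (H1 : ‖G (x +v INR J *v u +v h) -v G (x +v INR J *v u)‖ <= M)
      by (apply av_diff_le, H; lia).
    assert (H2 : ‖G (x +v h) -v G x‖ <= M) by (apply av_diff_le; now apply on_box_corner in H).
    rewrite ns_norm_scal, Rabs_pos_eq by trivial.
    replace (2 * M / INR J) with (/ INR J * (M + M)) by (field; lra).
    apply Rmult_le_compat_l; trivial. eapply Rle_trans; [apply norm_sub_le|]. lra.
  - replace (/ INR J *v vsum J (fun j => G (x +v u +v h +v INR j *v v)) -v
        / INR J *v vsum J (fun j => G (x +v u +v INR j *v v)) -v
        (/ INR J *v vsum J (fun j => G (x +v h +v INR j *v v)) -v
         / INR J *v vsum J (fun j => G (x +v INR j *v v))))
      with (/ INR J *v vsum J (fun j =>
        (G (x +v INR j *v v +v u +v h) -v G (x +v INR j *v v +v u)) -v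
        (G (x +v INR j *v v +v h) -v G (x +v INR j *v v)))).
    + eapply Rle_trans; [apply mean_norm|]. apply mean_le. intros j Hj. apply IH; trivial.
      apply H. lia.
    + rewrite vsum_sub, vsum_sub, vsum_sub.
      rewrite (vsum_ext J (fun j => G (x +v u +v h +v INR j *v v))
        (fun j => G (x +v INR j *v v +v u +v h))) by (intros; f_equal; vring).
      rewrite (vsum_ext J (fun j => G (x +v u +v INR j *v v))
        (fun j => G (x +v INR j *v v +v u))) by (intros; f_equal; vring).
      rewrite (vsum_ext J (fun j => G (x +v h +v INR j *v v))
        (fun j => G (x +v INR j *v v +v h))) by (intros; f_equal; vring).
      vring.
Qed.

Lemma av_close {X : NormedSpace} F (f : Z -> X) L x : 0 <= L ->
  on_box J F (fun y => ‖f y -v f x‖ <= L * ‖y -v x‖) x ->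
  ‖av J F f x -v f x‖ <= L * (INR J * lsum F (fun v => ‖v‖)).
Proof.
  intros HL.
  (* The corner of the box moves away from [x] during the induction, so it is made a free point
     [z]. *)
  enough (G : forall z, on_box J F (fun y => ‖f y -v f x‖ <= L * ‖y -v x‖) z ->
    ‖av J F f z -v f x‖ <= L * (‖z -v x‖ + INR J * lsum F (fun v => ‖v‖))).
  { intro H. apply G in H. rewrite norm_sub_0, Rplus_0_l in H. exact H. }
  induction F as [|v F IH]; intros z H.
  - simpl in *. rewrite Rmult_0_r, Rplus_0_r. exact H.
  - cbn [av lsum].
    replace (/ INR J *v vsum J (fun j => av J F f (z +v INR j *v v)) -v f x)
      with (/ INR J *v vsum J (fun j => av J F f (z +v INR j *v v) -v f x)).
    + eapply Rle_trans; [apply mean_norm|]. apply mean_le. intros j Hj.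
      eapply Rle_trans; [apply IH, H; lia|]. apply Rmult_le_compat_l; trivial.
      assert (‖z +v INR j *v v -v x‖ <= ‖z -v x‖ + ‖INR j *v v‖) by (apply norm_le_of_eq; vring).
      rewrite ns_norm_scal, Rabs_pos_eq in H0 by apply pos_INR.
      assert (INR j * ‖v‖ <= INR J * ‖v‖).
      { apply Rmult_le_compat_r; [apply ns_norm_nonneg|]. apply le_INR. lia. }
      lra.
    + rewrite vsum_sub, vsum_const. vfield; lra.
Qed.

(** The steps along [v] add up to one long increment. An additive error [kappa] in a lower bound for
    that increment thus costs only [kappa / J] in the mean step. *)
Lemma mean_diff_ge {X : NormedSpace} (f : Z -> X) v x :
  / INR J * ‖f (x +v INR J *v v) -v f x‖ <=
  / INR J * rsum J (fun j => ‖f (x +v INR j *v v +v v) -v f (x +v INR j *v v)‖).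
Proof.
  apply Rmult_le_compat_l; trivial. set (g := fun i => f (x +v INR i *v v)).
  replace (f (x +v INR J *v v) -v f x) with (vsum J (fun j => g (S j) -v g j)).
  - unfold g. eapply Rle_trans; [apply vsum_norm|]. apply rsum_le. intros j _.
    replace (x +v INR j *v v +v v) with (x +v INR (S j) *v v); [lra|]. rewrite S_INR. vring.
  - rewrite (vsum_telescope J g). unfold g. do 2 f_equal. simpl. vring.
Qed.

End Averages.

(** * Discretization *)

Definition lat {Z : NormedSpace} (h : R) (es : list Z) (k : nat) : Z -> Prop :=
  comb (fun a => exists n : BinNums.Z, a = IZR n * h /\ (Z.abs n <= Z.of_nat k)%Z) is_zero es.

Section Lattice.
Context {Z : NormedSpace} (h : R).

Lemma lat_zero (es : list Z) k : lat h es k ns_zero.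
Proof.
  induction es as [|e es IH]; [reflexivity|].
  exists 0, ns_zero. repeat split; trivial; [|vring]. exists 0%Z. split; [ring|lia].
Qed.

Lemma lat_add (es : list Z) k m x y : lat h es k x -> lat h es m y -> lat h es (k + m) (x +v y).
Proof.
  revert x y; induction es as [|e es IH]; intros x y.
  - intros -> ->. unfold lat, comb, is_zero. vring.
  - intros (a & x' & (n & -> & Hn) & Hx & ->) (b & y' & (n' & -> & Hn') & Hy & ->).
    exists (IZR (n + n') * h), (x' +v y'). repeat split; [|apply IH; trivial|].
    + exists (n + n')%Z. split; trivial. lia.
    + rewrite plus_IZR. vring.
Qed.

Lemma lat_opp (es : list Z) k x : lat h es k x -> lat h es k ((-1) *v x).
Proof.
  revert x; induction es as [|e es IH]; intros x.
  - intros ->. unfold lat, comb, is_zero. vring.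
  - intros (a & x' & (n & -> & Hn) & Hx & ->).
    exists (IZR (- n) * h), ((-1) *v x'). repeat split; [|apply IH; trivial|].
    + exists (- n)%Z. split; trivial. lia.
    + rewrite opp_IZR. vring.
Qed.

Lemma lat_mono (es : list Z) k m x : (k <= m)%nat -> lat h es k x -> lat h es m x.
Proof.
  intro H. apply comb_weaken; trivial. intros a (n & -> & Hn). exists n. split; trivial. lia.
Qed.

Lemma lat_mult (es : list Z) k v j : lat h es k v -> lat h es (j * k) (INR j *v v).
Proof.
  intro Hv. induction j as [|j IH].
  - simpl. replace (0 *v v) with (ns_zero : Z) by vring. apply lat_zero.
  - rewrite S_INR. replace ((INR j + 1) *v v) with (v +v INR j *v v) by vring.
    now apply lat_add.
Qed.

Lemma lat_basis (es : list Z) k e : (1 <= k)%nat -> In e es -> lat h es k (h *v e).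
Proof.
  intro Hk. induction es as [|e' es IH]; [intros []|intros [->|He]].
  - exists (1 * h), ns_zero. repeat split; [|apply lat_zero|vring].
    exists 1%Z. split; trivial. lia.
  - exists 0, (h *v e). repeat split; [|now apply IH|vring]. exists 0%Z. split; [ring|lia].
Qed.

Lemma lat_span (es : list Z) k x : lat h es k x -> span es x.
Proof. now apply comb_weaken. Qed.

Lemma lat_list (es : list Z) k : exists l, forall x, lat h es k x -> In x l.
Proof.
  induction es as [|e es (l & Hl)].
  - exists (ns_zero :: nil). intros x ->. now left.
  - exists (flat_map (fun i => map (fun y => (IZR (Z.of_nat i - Z.of_nat k) * h) *v e +v y) l)
      (seq 0 (2 * k + 1))).
    intros x (a & y & (n & -> & Hn) & Hy & ->). apply in_flat_map.
    exists (Z.to_nat (n + Z.of_nat k)). split.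
    + apply in_seq. lia.
    + apply in_map_iff. exists y. split; [|now apply Hl].
      do 3 f_equal. f_equal. lia.
Qed.

(** Each direction of [F] moves a coordinate by at most [Q] units, at most [J] times. *)
Lemma on_box_lat (es : list Z) J F Q k (P : Z -> Prop) x :
  (forall v, In v F -> lat h es Q v) -> lat h es k x ->
  (forall y, lat h es (k + length F * (J * Q)) y -> P y) -> on_box J F P x.
Proof.
  revert k x; induction F as [|v F IH]; intros k x HF Hx HP; simpl.
  - apply HP. rewrite Nat.add_0_r. exact Hx.
  - intros j Hj. apply (IH (k + J * Q)%nat).
    + intros u Hu. apply HF. now right.
    + apply lat_add; trivial. apply (lat_mono _ (j * Q)).
      * apply Nat.mul_le_mono_r; trivial.
      * apply lat_mult, HF. now left.
    + intros y Hy. apply HP. simpl. now rewrite Nat.add_assoc.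
Qed.

End Lattice.

(** * Descent on the variation *)

Section Descent.
Context {Z : NormedSpace} (h : R) (es F : list Z) (Q : nat) (L eps : R).
Hypothesis HF : forall v, In v F -> lat h es Q v.
Hypothesis HL : 0 <= L.
Hypothesis Heps : 0 < eps.

(** Averaging preserves the Lipschitz bound but moves values by a bounded amount, so the lower bound
    survives only up to an additive [kappa], which grows from step to step. *)
Definition coarse_embedding {X : NormedSpace} (f : Z -> X) (k : nat) (kappa : R) : Prop :=
  forall x y, lat h es k x -> lat h es k y ->
    ‖f x -v f y‖ <= L * ‖x -v y‖ /\ ‖x -v y‖ - kappa <= ‖f x -v f y‖.

Definition variation {X : NormedSpace} (f : Z -> X) (x : Z) : R :=
  lsum F (fun w => ‖f (x +v w) -v f x‖).

Definition almost_linear_at {X : NormedSpace} (f : Z -> X) (x : Z) : Prop :=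
  (forall v, In v F -> ‖v‖ - eps <= ‖f (x +v v) -v f x‖ <= L * ‖v‖) /\
  (forall u v, In u F -> In v F ->
     ‖(f (x +v u +v v) -v f (x +v u)) -v (f (x +v v) -v f x)‖ <= eps).

(* Averaging cannot increase the increments of [f]. If an averaged increment is shorter than
   it should be, then, the averages of the norms of the increments being long enough, the
   variation has dropped by a definite amount. *)
Lemma smoothing_step (kappa : R) : 0 <= kappa -> exists sigma kappa1, 0 <= kappa1 /\
  forall (X : NormedSpace) (f : Z -> X) k m,
    coarse_embedding f (3 * k + sigma) kappa ->
    (forall x, lat h es (3 * k + sigma) x -> variation f x <= m) ->
    exists g : Z -> X, (exists x, almost_linear_at g x) \/
      (coarse_embedding g k kappa1 /\ forall x, lat h es k x -> variation g x <= m - eps / 2).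
Proof.
  intros Hk. set (R0 := lsum F (fun v => ‖v‖)).
  assert (HR : forall v, In v F -> ‖v‖ <= R0).
  { intros v Hv. apply (lsum_in_le F (fun v => ‖v‖)); trivial. intros; apply ns_norm_nonneg. }
  assert (HR0 : 0 <= R0) by (apply lsum_nonneg; intros; apply ns_norm_nonneg).
  assert (HLR : 0 <= L * R0) by (apply Rmult_le_pos; trivial).
  (* [J] makes two errors small: [kappa / J <= eps / 2] in the mean increments and
     [2 L R0 / J <= eps] in the second differences. The summand 1 ensures [J >= 1]. *)
  destruct (exists_nat_ge ((2 * kappa + 2 * (L * R0)) / eps + 1)) as (J & HJ).
  assert (HJ0 : 0 <= (2 * kappa + 2 * (L * R0)) / eps).
  { apply Rmult_le_pos; [lra|]. left. now apply Rinv_0_lt_compat. }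
  assert (HJ1 : (1 <= J)%nat) by (apply INR_le; simpl; lra).
  assert (HJp : 0 < INR J) by lra.
  assert (HJe : 2 * kappa + 2 * (L * R0) <= INR J * eps).
  { apply Rmult_le_reg_r with (/ eps); [now apply Rinv_0_lt_compat|].
    rewrite Rmult_assoc, Rinv_r by lra. unfold Rdiv in HJ. lra. }
  assert (HJk : kappa / INR J <= eps / 2).
  { apply Rmult_le_reg_r with (INR J); trivial. unfold Rdiv at 1.
    rewrite Rmult_assoc, Rinv_l by lra. lra. }
  set (sg := (length F * (J * Q))%nat).
  (* Averaging enlarges the coordinates by [sg], a long increment by [J Q] and a single one by [Q].
     The [3 k] comes from translating the box at [y] by [x - y], whose coordinates reach [2 k]. The
     new additive error is the old one plus the displacements of two values. *)
  exists (sg + J * Q + Q)%nat, (kappa + 2 * (L * (INR J * R0))). split.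
  { assert (0 <= L * (INR J * R0)) by (repeat apply Rmult_le_pos; lra). lra. }
  intros X f k m Hf Hm. exists (av J F f).
  assert (Hbox : forall (P : Z -> Prop) i x, (i <= 3 * k)%nat -> lat h es i x ->
    (forall y, lat h es (3 * k + sg) y -> P y) -> on_box J F P x).
  { intros P i x Hi Hx HP. apply (on_box_lat h es J F Q i); trivial.
    intros y Hy. apply HP. apply (lat_mono h es (i + length F * (J * Q))); trivial. unfold sg. lia. }
  assert (Hin : forall i y, (i <= 3 * k + (sg + J * Q + Q))%nat -> lat h es i y ->
    lat h es (3 * k + (sg + J * Q + Q)) y) by (intros; eapply lat_mono; eauto).
  assert (Hstep : forall w y, In w F -> lat h es (3 * k + sg) y ->
    ‖f (y +v w) -v f y‖ <= L * ‖w‖).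
  { intros w y Hw Hy. replace w with (y +v w -v y) at 2 by vring. apply Hf.
    - apply (Hin (3 * k + sg + Q)%nat); [lia|]. apply lat_add; auto.
    - apply (Hin (3 * k + sg)%nat); [lia|trivial]. }
  assert (Hmean : forall v x, In v F -> lat h es k x ->
    ‖v‖ - eps / 2 <= rav J F (fun y => ‖f (y +v v) -v f y‖) x).
  { intros v x Hv Hx. apply (rav_ge_of_mean J HJ1 F v); trivial.
    apply (Hbox _ k); trivial; [lia|]. intros y Hy.
    eapply Rle_trans; [|apply (mean_diff_ge J HJ1 f)].
    destruct (Hf (y +v INR J *v v) y) as (_ & H).
    - apply (Hin (3 * k + sg + J * Q)%nat); [lia|]. apply lat_add; trivial. apply lat_mult; auto.
    - apply (Hin (3 * k + sg)%nat); [lia|trivial].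
    - replace (y +v INR J *v v -v y) with (INR J *v v) in H by vring.
      rewrite ns_norm_scal, Rabs_pos_eq in H by lra.
      apply Rle_trans with (/ INR J * (INR J * ‖v‖ - kappa)).
      + replace (/ INR J * (INR J * ‖v‖ - kappa)) with (‖v‖ - kappa / INR J) by (field; lra). lra.
      + apply Rmult_le_compat_l; trivial. left. now apply Rinv_0_lt_compat. }
  assert (Hclose : forall x, lat h es k x -> ‖av J F f x -v f x‖ <= L * (INR J * R0)).
  { intros x Hx. apply (av_close J HJ1 F f L x); trivial. apply (Hbox _ k); trivial; [lia|].
    intros y Hy. apply Hf; [apply (Hin (3 * k + sg)%nat)|apply (Hin k)]; trivial; lia. }
  assert (Hup : forall v x, In v F -> lat h es k x -> ‖av J F f (x +v v) -v av J F f x‖ <= L * ‖v‖).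
  { intros v x Hv Hx. apply (av_diff_le J HJ1). apply (Hbox _ k); trivial; [lia|]. auto. }
  destruct (classic (exists x, lat h es k x /\
    forall v, In v F -> ‖v‖ - eps <= ‖av J F f (x +v v) -v av J F f x‖)) as [(x & Hx & Hgood)|Hbad].
  - left. exists x. split; [split; auto|]. intros u v Hu Hv.
    eapply Rle_trans.
    { apply (av_second_diff J HJ1 F f u v (L * R0)); trivial. apply (Hbox _ k); trivial; [lia|].
      intros y Hy. eapply Rle_trans; [apply Hstep; trivial|]. apply Rmult_le_compat_l; auto. }
    apply Rmult_le_reg_r with (INR J); trivial. unfold Rdiv. rewrite Rmult_assoc, Rinv_l by lra. lra.
  - right. split.
    + intros x y Hx Hy. split.
      * replace (av J F f x) with (av J F f (y +v (x -v y))) by (f_equal; vring).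
        apply (av_diff_le J HJ1). apply (on_box_lat h es J F Q k); trivial. intros z Hz.
        fold sg in Hz. replace (‖x -v y‖) with (‖z +v (x -v y) -v z‖) by (f_equal; vring).
        apply Hf; [|apply (Hin (k + sg)%nat); trivial; lia].
        apply (Hin (k + sg + (k + k))%nat); [lia|]. apply lat_add; trivial.
        replace (x -v y) with (x +v (-1) *v y) by vring. apply lat_add; trivial.
        now apply lat_opp.
      * destruct (Hf x y) as (_ & H); [apply (Hin k); trivial; lia..|].
        pose proof (Hclose x Hx) as H1. pose proof (Hclose y Hy) as H2.
        assert (‖f x -v f y‖ <= ‖av J F f x -v f x‖ +
          (‖av J F f x -v av J F f y‖ + ‖av J F f y -v f y‖)).
        { rewrite (norm_sub_sym (av J F f x) (f x)).
          apply Rle_trans with (‖f x -v av J F f x‖ + ‖av J F f x -v f y‖).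
          - apply norm_le_of_eq. vring.
          - apply Rplus_le_compat_l. apply norm_le_of_eq. vring. }
        lra.
    + intros x Hx.
      assert (Hv : exists v, In v F /\ ‖av J F f (x +v v) -v av J F f x‖ < ‖v‖ - eps).
      { apply NNPP. intro Hn. apply Hbad. exists x. split; trivial. intros v Hv.
        apply Rnot_lt_le. intro Hlt. apply Hn. now exists v. }
      destruct Hv as (v & Hv & Hlt).
      enough (variation (av J F f) x + eps / 2 <= m) by lra.
      apply Rle_trans with (rav J F (variation f) x).
      * unfold variation. rewrite rav_lsum. apply (lsum_le_gap F) with v; trivial.
        -- intros w Hw. apply (av_diff_norm J HJ1).
        -- pose proof (Hmean v x Hv Hx). lra.
      * rewrite <- (rav_const J HJ1 F m x). apply (rav_le J HJ1). apply (Hbox _ k); trivial; [lia|].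
        intros y Hy. apply Hm. apply (Hin (3 * k + sg)%nat); [lia|trivial].
Qed.

(** Each unsuccessful step lowers the variation by [eps / 2], and it cannot become negative. The
    order of quantifiers is essential: [k] is chosen before [X] and [f], so one finite set serves
    for all of them; it is computed backwards from the last step. *)
Lemma descent (K : nat) : forall kappa, 0 <= kappa -> exists k, forall (X : NormedSpace) (f : Z -> X),
  coarse_embedding f k kappa ->
  (forall x, lat h es k x -> variation f x <= INR K * (eps / 2)) ->
  exists (g : Z -> X) x, almost_linear_at g x.
Proof.
  induction K as [|K IH]; intros kappa Hk;
    destruct (smoothing_step kappa Hk) as (sg & kappa1 & Hk1 & Hstep).
  - exists (3 * 0 + sg)%nat. intros X f Hf Hv.
    destruct (Hstep X f 0%nat _ Hf Hv) as (g & [Hg|(_ & Hg)]); [now exists g|].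
    specialize (Hg ns_zero (lat_zero h es 0)). simpl in Hg.
    assert (0 <= variation g ns_zero) by (apply lsum_nonneg; intros; apply ns_norm_nonneg). lra.
  - destruct (IH kappa1 Hk1) as (k & IHk).
    exists (3 * k + sg)%nat. intros X f Hf Hv.
    destruct (Hstep X f k _ Hf Hv) as (g & [Hg|(Hg1 & Hg2)]); [now exists g|].
    apply (IHk X g); trivial. intros x Hx. specialize (Hg2 x Hx). rewrite S_INR in Hg2. lra.
Qed.

End Descent.

(** * From almost additive to linear *)

Lemma comb_norm {Z : NormedSpace} c (es : list Z) z :
  comb (fun a => Rabs a <= c) is_zero es z -> ‖z‖ <= c * lsum es (fun e => ‖e‖).
Proof.
  revert z; induction es as [|e es IH]; intros z; simpl.
  - intros ->. rewrite norm_0. lra.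
  - intros (a & y & Ha & Hy & ->). apply IH in Hy.
    pose proof (ns_norm_triangle _ (a *v e) y) as H. rewrite ns_norm_scal in H.
    assert (Rabs a * ‖e‖ <= c * ‖e‖) by (apply Rmult_le_compat_r; [apply ns_norm_nonneg|trivial]).
    lra.
Qed.

Lemma linear_on_zero {Z X : NormedSpace} (W : Z -> Prop) (T : Z -> X) :
  is_subspace W -> linear_on W T -> T ns_zero = ns_zero.
Proof.
  intros HW (_ & Hs). rewrite <- (scal_0_r 0), Hs; [apply scal_0_l|apply HW|].
  apply HW, HW.
Qed.

Lemma linear_on_sub {Z X : NormedSpace} (W : Z -> Prop) (T : Z -> X) x y :
  is_subspace W -> linear_on W T -> W x -> W y -> T (x -v y) = T x -v T y.
Proof.
  intros HW (Ha & Hs) Hx Hy. replace (x -v y) with (x +v (-1) *v y) by vring.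
  assert (W ((-1) *v y)) by (apply HW; trivial). rewrite Ha, Hs by trivial. vring.
Qed.

Lemma comb_map {Z X : NormedSpace} (W : Z -> Prop) (T : Z -> X) P es z :
  is_subspace W -> linear_on W T -> (forall e, In e es -> W e) ->
  comb P is_zero es z -> W z /\ comb P is_zero (map T es) (T z).
Proof.
  intros HW HT. revert z; induction es as [|e es IH]; intros z He; simpl.
  - intros ->. split; [apply HW|]. now apply (linear_on_zero W).
  - intros (a & y & Ha & Hy & ->). destruct (IH y) as (Wy & Hc); trivial.
    { intros; apply He; now right. }
    assert (We : W e) by (apply He; now left). assert (Wae : W (a *v e)) by now apply HW.
    split; [now apply HW|]. exists a, (T y). repeat split; trivial.
    destruct HT as (Hta & Hts). now rewrite Hta, Hts by trivial.
Qed.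

(** Each coordinate is rounded up to a multiple of [h], so the integers have size at most
    [B / h + 1]. *)
Lemma lat_approx {Z : NormedSpace} h B (es : list Z) : 0 < h -> exists Q, (1 <= Q)%nat /\
  forall y, comb (fun a => Rabs a <= B) is_zero es y ->
    exists v, lat h es Q v /\ comb (fun a => Rabs a <= h) is_zero es (y -v v).
Proof.
  intros Hh. destruct (exists_nat_ge (B / h + 1)) as (Q & HQ). exists (S Q). split; [lia|].
  induction es as [|e es IH]; intros y.
  - intros ->. exists ns_zero. split; [reflexivity|]. simpl. unfold is_zero. vring.
  - intros (a & y' & Ha & Hy & ->). destruct (IH y' Hy) as (v & Hv & Hc).
    destruct (archimed (a / h)) as (H1 & H2). set (n := up (a / h)) in *.
    assert (E : a = a / h * h) by (field; lra).
    exists ((IZR n * h) *v e +v v). split.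
    + exists (IZR n * h), v. repeat split; trivial. exists n. split; trivial.
      apply le_IZR. rewrite abs_IZR, <- INR_IZR_INZ, S_INR.
      assert (Rabs (a / h) <= B / h).
      { unfold Rdiv. rewrite Rabs_mult, (Rabs_pos_eq (/ h)).
        - apply Rmult_le_compat_r; trivial. left. now apply Rinv_0_lt_compat.
        - left. now apply Rinv_0_lt_compat. }
      pose proof (Rle_abs (a / h)). pose proof (Rle_abs (- (a / h))). rewrite Rabs_Ropp in *.
      apply Rabs_le. lra.
    + exists (a - IZR n * h), (y' -v v). repeat split; trivial; [|vring].
      replace (a - IZR n * h) with ((a / h - IZR n) * h) by (field; lra).
      rewrite Rabs_mult, (Rabs_pos_eq h) by lra.
      assert (Rabs (a / h - IZR n) <= 1) by (apply Rabs_le; lra).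
      assert (Rabs (a / h - IZR n) * h <= 1 * h) by (apply Rmult_le_compat_r; lra). lra.
Qed.

(** Adding 1 repeatedly costs [d] each time, and [b 0] has norm at most [d]. For negative [n],
    comparing [b n] with [b (- n)] and [b 0] costs two more errors; hence [Q + 3]. *)
Lemma almost_additive_int {X : NormedSpace} (b : BinNums.Z -> X) (Q : nat) d : (1 <= Q)%nat ->
  (forall m n, (Z.abs m <= Z.of_nat Q)%Z -> (Z.abs n <= Z.of_nat Q)%Z ->
    ‖b (m + n)%Z -v b m -v b n‖ <= d) ->
  forall n, (Z.abs n <= Z.of_nat Q)%Z -> ‖b n -v IZR n *v b 1%Z‖ <= (INR Q + 3) * d.
Proof.
  intros HQ H.
  assert (Hd : 0 <= d).
  { eapply Rle_trans; [apply ns_norm_nonneg|apply (H 0%Z 0%Z); lia]. }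
  assert (Hnat : forall n, (n <= Q)%nat ->
    ‖b (Z.of_nat n) -v INR n *v b 1%Z‖ <= (INR n + 1) * d).
  { induction n as [|n IH]; intro Hn.
    - simpl. pose proof (H 0%Z 0%Z ltac:(lia) ltac:(lia)) as H0. simpl in H0.
      replace (b 0%Z -v 0 *v b 1%Z) with (ns_opp (b 0%Z -v b 0%Z -v b 0%Z)) by vring.
      rewrite norm_opp. lra.
    - pose proof (H (Z.of_nat n) 1%Z ltac:(lia) ltac:(lia)) as H1.
      replace (Z.of_nat (S n)) with (Z.of_nat n + 1)%Z by lia. specialize (IH ltac:(lia)).
      rewrite S_INR.
      assert (‖b (Z.of_nat n + 1)%Z -v (INR n + 1) *v b 1%Z‖ <=
        ‖b (Z.of_nat n + 1)%Z -v b (Z.of_nat n) -v b 1%Z‖ + ‖b (Z.of_nat n) -v INR n *v b 1%Z‖)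
        by (apply norm_le_of_eq; vring).
      lra. }
  intros n Hn. destruct (Z_le_gt_dec 0 n) as [Hp|Hp].
  - specialize (Hnat (Z.to_nat n) ltac:(lia)). rewrite INR_IZR_INZ, Z2Nat.id in Hnat by trivial.
    assert (IZR n <= INR Q) by (rewrite INR_IZR_INZ; apply IZR_le; lia).
    assert ((IZR n + 1) * d <= (INR Q + 3) * d) by (apply Rmult_le_compat_r; lra). lra.
  - specialize (Hnat (Z.to_nat (- n)) ltac:(lia)).
    rewrite INR_IZR_INZ, Z2Nat.id, opp_IZR in Hnat by lia.
    pose proof (H n (- n)%Z ltac:(lia) ltac:(lia)) as H1.
    pose proof (H 0%Z 0%Z ltac:(lia) ltac:(lia)) as H0. rewrite Z.add_opp_diag_r in H1. simpl in H0.
    assert (- IZR n <= INR Q) by (rewrite <- opp_IZR, INR_IZR_INZ; apply IZR_le; lia).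
    assert ((- IZR n + 1) * d <= (INR Q + 1) * d) by (apply Rmult_le_compat_r; lra).
    assert (‖b n -v IZR n *v b 1%Z‖ <= ‖ns_opp (b 0%Z -v b n -v b (- n)%Z)‖ +
      ‖ns_opp (b 0%Z -v b 0%Z -v b 0%Z) -v (b (- n)%Z -v - IZR n *v b 1%Z)‖)
      by (apply norm_le_of_eq; vring).
    pose proof (norm_sub_le (ns_opp (b 0%Z -v b 0%Z -v b 0%Z)) (b (- n)%Z -v - IZR n *v b 1%Z)).
    rewrite norm_opp in *. lra.
Qed.

(** One coordinate at a time: splitting it off costs [d], and [almost_additive_int] costs
    [(Q + 3) d]. The leading 1 accounts for [a] at the origin. *)
Lemma almost_additive_lat {Z X : NormedSpace} (W : Z -> Prop) h (a : Z -> X) (T : Z -> X) Q d es :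
  0 < h -> (1 <= Q)%nat -> is_subspace W -> linear_on W T -> (forall e, In e es -> W e) ->
  (forall e, In e es -> T e = / h *v a (h *v e)) ->
  (forall u v, lat h es Q u -> lat h es Q v -> ‖a (u +v v) -v a u -v a v‖ <= d) ->
  forall v, lat h es Q v -> ‖a v -v T v‖ <= (1 + INR (length es) * (INR Q + 4)) * d.
Proof.
  intros Hh HQ HW HT. revert d. induction es as [|e es IH]; intros d HeW HTe Ha v.
  - intros ->. rewrite (linear_on_zero W T HW HT). simpl.
    pose proof (Ha ns_zero ns_zero eq_refl eq_refl) as H.
    replace (ns_zero +v ns_zero) with (ns_zero : Z) in H by vring.
    replace (a ns_zero -v ns_zero) with (ns_opp (a ns_zero -v a ns_zero -v a ns_zero)) by vring.
    rewrite norm_opp. lra.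
  - intros (c & y & (n & -> & Hn) & Hy & ->). fold (lat h es Q) in Hy.
    assert (Hsub : forall z, lat h es Q z -> lat h (e :: es) Q z).
    { intros z Hz. exists 0, z. repeat split; trivial; [|vring]. exists 0%Z. split; [ring|lia]. }
    assert (Hmul : forall m, (Z.abs m <= Z.of_nat Q)%Z -> lat h (e :: es) Q ((IZR m * h) *v e)).
    { intros m Hm. exists (IZR m * h), ns_zero. repeat split; [now exists m|apply lat_zero|vring]. }
    specialize (IH d ltac:(intros; apply HeW; now right) ltac:(intros; apply HTe; now right)
      ltac:(intros; apply Ha; auto) y Hy).
    pose proof (almost_additive_int (fun m => a ((IZR m * h) *v e)) Q d HQ) as Hint.
    cbv beta in Hint. specialize (Hint ltac:(intros m m' Hm Hm';
      replace ((IZR (m + m') * h) *v e) with ((IZR m * h) *v e +v (IZR m' * h) *v e)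
        by (rewrite plus_IZR; vring); apply Ha; auto) n Hn).
    assert (We : W e) by (apply HeW; now left).
    assert (Wy : W y).
    { apply (span_min W es); trivial; [|now apply lat_span in Hy].
      apply Forall_forall. intros; apply HeW; now right. }
    assert (ET : T ((IZR n * h) *v e +v y) = IZR n *v a ((IZR 1 * h) *v e) +v T y).
    { destruct HT as (Hta & Hts). assert (W ((IZR n * h) *v e)) by now apply HW.
      rewrite Hta, Hts, HTe by (trivial; now left). rewrite Rmult_1_l. vfield; lra. }
    rewrite ET.
    pose proof (Ha _ _ (Hmul n Hn) (Hsub y Hy)) as H1.
    set (an := a ((IZR n * h) *v e)) in *. set (a1 := a ((IZR 1 * h) *v e)) in *.
    set (A := a ((IZR n * h) *v e +v y)) in *.
    assert (‖A -v (IZR n *v a1 +v T y)‖ <= ‖A -v an -v a y‖ + ‖(an -v IZR n *v a1) +v (a y -v T y)‖)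
      by (apply norm_le_of_eq; vring).
    pose proof (ns_norm_triangle _ (an -v IZR n *v a1) (a y -v T y)).
    cbn [length]. rewrite S_INR. lra.
Qed.

(** [A] is fixed before the target and the map, and the constants 2 and [3 D] do not depend on the
    dimension of [S]. *)
Theorem discretization {Z : NormedSpace} (S : Z -> Prop) (D : R) :
  is_subspace S -> finite_dim S -> 1 <= D ->
  exists A : list Z, A <> nil /\ NoDup A /\ Forall S A /\
    forall (X : NormedSpace) (f : Z -> X),
      (forall x y, In x A -> In y A -> ‖x -v y‖ <= ‖f x -v f y‖ <= D * ‖x -v y‖) ->
      exists T : Z -> X, linear_on S T /\
        forall x, S x -> ‖x‖ <= 2 * ‖T x‖ /\ ‖T x‖ <= 3 * D * ‖x‖.
Proof.
  intros HS Hfd HD. destruct (basis_exists S HS Hfd) as (es & Hes & HSes).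
  destruct (indep_coef_bound es Hes) as (B & HB & HBy).
  set (s := lsum es (fun e => ‖e‖)).
  assert (Hs : 0 <= s) by (apply lsum_nonneg; intros; apply ns_norm_nonneg).
  (* On the unit sphere four errors of at most [1/8] are subtracted from 1: rounding to the lattice,
     [eps], the deviation of [a] from [T], and [T] of the rounding error. The remaining [1/2] gives
     the factor 2. *)
  set (eta := / (8 * D)).
  assert (Heta : 0 < eta) by (apply Rinv_0_lt_compat; lra).
  assert (HetaD : D * eta = / 8) by (unfold eta; field; lra).
  assert (Hetale : eta <= / 8) by (assert (1 * eta <= D * eta) by (apply Rmult_le_compat_r; lra); lra).
  set (h := eta / (s + 1)).
  assert (Hh : 0 < h) by (apply Rdiv_lt_0_compat; lra).
  assert (Hhs : h * s <= eta).
  { unfold h. apply Rmult_le_reg_r with (s + 1); [lra|].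
    replace (eta / (s + 1) * s * (s + 1)) with (eta * s) by (field; lra).
    apply Rmult_le_compat_l; lra. }
  destruct (lat_approx h B es Hh) as (Q & HQ & Happ).
  destruct (lat_list h es Q) as (F0 & HF0).
  (* [lat_list] gives a list that may contain other vectors; the filter leaves exactly the lattice
     points. *)
  set (F := filter (fun v => if excluded_middle_informative (lat h es Q v) then true else false) F0).
  assert (HF : forall v, In v F <-> lat h es Q v).
  { intro v. unfold F. rewrite filter_In.
    destruct (excluded_middle_informative (lat h es Q v)) as [H|H].
    - split; auto.
    - split; [intros (_ & H'); discriminate|tauto]. }
  set (N := 1 + INR (length es) * (INR Q + 4)).
  assert (HN : 1 <= N).
  { unfold N. assert (0 <= INR (length es) * (INR Q + 4)); [|lra].
    apply Rmult_le_pos; [apply pos_INR|]. pose proof (pos_INR Q). lra. }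
  (* [N] is the factor lost in [almost_additive_lat]. *)
  set (eps := eta / N).
  assert (Heps : 0 < eps) by (apply Rdiv_lt_0_compat; lra).
  assert (HNeps : N * eps = eta) by (unfold eps; field; lra).
  assert (Hepseta : eps <= eta).
  { rewrite <- HNeps. assert (1 * eps <= N * eps) by (apply Rmult_le_compat_r; lra). lra. }
  set (V := lsum F (fun v => D * ‖v‖)).
  destruct (exists_nat_ge (V / (eps / 2))) as (K & HK).
  assert (HK' : V <= INR K * (eps / 2)).
  { apply Rmult_le_compat_r with (r := eps / 2) in HK; [|lra].
    unfold Rdiv at 1 in HK. rewrite Rmult_assoc, Rinv_l in HK by lra. lra. }
  destruct (descent h es F Q D eps (fun v => proj1 (HF v)) ltac:(lra) Heps K 0 (Rle_refl 0)) as (k & Hk).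
  (* Radius [k + Q], because the variation at a point of radius [k] evaluates the map at its
     translates by [F]. *)
  destruct (lat_list h es (k + Q)) as (A0 & HA0).
  set (A1 := filter (fun v => if excluded_middle_informative (lat h es (k + Q) v)
    then true else false) A0).
  assert (HA1 : forall v, In v A1 <-> lat h es (k + Q) v).
  { intro v. unfold A1. rewrite filter_In.
    destruct (excluded_middle_informative (lat h es (k + Q) v)) as [H|H].
    - split; auto.
    - split; [intros (_ & H'); discriminate|tauto]. }
  set (A := nodup (fun x y : Z => excluded_middle_informative (x = y)) A1).
  assert (HA : forall v, In v A <-> lat h es (k + Q) v).
  { intro v. unfold A. now rewrite nodup_In. }
  exists A. split; [|split; [|split]].
  - intro E. assert (H : In ns_zero A) by (apply HA; apply lat_zero). now rewrite E in H.
  - apply NoDup_nodup.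
  - apply Forall_forall. intros x Hx. apply HSes. apply HA in Hx. now apply lat_span in Hx.
  - intros X f Hf.
    destruct (Hk X f) as (g & x0 & Hg1 & Hg2).
    { intros x y Hx Hy. assert (In x A) by (apply HA; apply (lat_mono h es k); trivial; lia).
      assert (In y A) by (apply HA; apply (lat_mono h es k); trivial; lia).
      split; [now apply Hf|]. rewrite Rminus_0_r. now apply Hf. }
    { intros x Hx. eapply Rle_trans; [|exact HK']. apply lsum_le. intros v Hv.
      assert (lat h es (k + Q) (x +v v)) by (apply lat_add; trivial; now apply HF).
      assert (In x A) by (apply HA; apply (lat_mono h es k); trivial; lia).
      destruct (Hf (x +v v) x) as (_ & H1); trivial; [now apply HA|].
      now replace (x +v v -v x) with v in H1 by vring. }
    (* The increments at the good point [x0] are almost additive on the lattice; [T] is the linear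
       map with the same values on the vectors [h e]. *)
    set (a := fun v => g (x0 +v v) -v g x0).
    destruct (linear_extension es (fun e => / h *v a (h *v e)) Hes) as (T & HT & HTe).
    assert (HinW : forall e, In e es -> span es e).
    { intros e He. apply span_mod_in; trivial. apply subspace_zero. }
    pose proof (subspace_span es) as Hsub.
    assert (Hadd : forall v, lat h es Q v -> ‖a v -v T v‖ <= eta).
    { intros v Hv. rewrite <- HNeps.
      apply (almost_additive_lat (span es) h a T Q eps es); trivial.
      intros u w Hu Hw. specialize (Hg2 u w (proj2 (HF u) Hu) (proj2 (HF w) Hw)).
      unfold a. replace (x0 +v (u +v w)) with (x0 +v u +v w) by vring.
      replace (g (x0 +v u +v w) -v g x0 -v (g (x0 +v u) -v g x0) -v (g (x0 +v w) -v g x0))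
        with (g (x0 +v u +v w) -v g (x0 +v u) -v (g (x0 +v w) -v g x0)) by vring. trivial. }
    assert (HTfrac : forall z, comb (fun c => Rabs c <= h) is_zero es z -> ‖T z‖ <= D * eta).
    { intros z Hz. apply (comb_map (span es) T) in Hz; trivial. destruct Hz as (_ & Hz).
      apply comb_norm in Hz. rewrite lsum_map in Hz.
      assert (lsum es (fun e => ‖T e‖) <= D * s).
      { unfold s. rewrite <- lsum_scal. apply lsum_le. intros e He. rewrite HTe by trivial.
        rewrite ns_norm_scal, Rabs_pos_eq by (left; now apply Rinv_0_lt_compat).
        pose proof (lat_basis h es Q e HQ He) as H.
        destruct (Hg1 (h *v e) (proj2 (HF _) H)) as (_ & H1). fold (a (h *v e)) in H1.
        rewrite ns_norm_scal, Rabs_pos_eq in H1 by lra.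
        apply Rmult_le_reg_l with h; trivial. rewrite <- Rmult_assoc, Rinv_r by lra. lra. }
      assert (h * lsum es (fun e => ‖T e‖) <= h * (D * s)) by (apply Rmult_le_compat_l; lra).
      assert (D * (h * s) <= D * eta) by (apply Rmult_le_compat_l; lra). lra. }
    assert (Hunit : forall y, span es y -> ‖y‖ = 1 -> 1 <= 2 * ‖T y‖ /\ ‖T y‖ <= 3 * D).
    { intros y Hy H1. specialize (HBy y Hy). rewrite H1, Rmult_1_r in HBy.
      destruct (Happ y HBy) as (v & Hv & Hfr).
      pose proof (lat_span h es Q v Hv) as Hspv.
      pose proof (HTfrac _ Hfr) as H2. rewrite (linear_on_sub (span es) T) in H2 by trivial.
      apply comb_norm in Hfr. fold s in Hfr.
      pose proof (Hadd v Hv) as H3. destruct (Hg1 v (proj2 (HF v) Hv)) as (H4 & H5).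
      fold (a v) in H4, H5.
      assert (‖y‖ <= ‖v‖ + ‖y -v v‖) by (apply norm_le_of_eq; vring).
      assert (‖v‖ <= ‖y‖ + ‖ns_opp (y -v v)‖) by (apply norm_le_of_eq; vring).
      assert (‖a v‖ <= ‖T y‖ + ‖(a v -v T v) -v (T y -v T v)‖) by (apply norm_le_of_eq; vring).
      pose proof (norm_sub_le (a v -v T v) (T y -v T v)).
      assert (‖T y‖ <= ‖a v‖ + ‖(T y -v T v) -v (a v -v T v)‖) by (apply norm_le_of_eq; vring).
      pose proof (norm_sub_le (T y -v T v) (a v -v T v)).
      rewrite norm_opp in *.
      assert (D * ‖v‖ <= D * (1 + eta)) by (apply Rmult_le_compat_l; lra).
      split; lra. }
    exists T. split.
    + destruct HT as (Hta & Hts). split.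
      * intros x y Hx Hy. apply Hta; now apply HSes.
      * intros c x Hx Hcx. apply Hts; now apply HSes.
    + intros x Hx. apply HSes in Hx. destruct (Req_dec (‖x‖) 0) as [H0|H0].
      { pose proof (ns_norm_nonneg _ (T x)). rewrite H0. split; [lra|].
        apply ns_norm_eq0 in H0. rewrite H0, (linear_on_zero (span es) T) by trivial.
        rewrite norm_0. lra. }
      assert (Hn : 0 < ‖x‖) by (pose proof (ns_norm_nonneg _ x); lra).
      assert (Hsx : span es (/ ‖x‖ *v x)) by (now apply Hsub).
      destruct (Hunit (/ ‖x‖ *v x)) as (H1 & H2); trivial.
      { rewrite ns_norm_scal, Rabs_pos_eq by (left; now apply Rinv_0_lt_compat). now apply Rinv_l. }
      destruct HT as (Hta & Hts). rewrite Hts in H1, H2 by trivial.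
      rewrite ns_norm_scal, Rabs_pos_eq in H1, H2 by (left; now apply Rinv_0_lt_compat).
      apply Rmult_le_compat_l with (r := ‖x‖) in H1; [|lra].
      apply Rmult_le_compat_l with (r := ‖x‖) in H2; [|lra].
      replace (‖x‖ * (2 * (/ ‖x‖ * ‖T x‖))) with (2 * ‖T x‖) in H1 by (field; trivial).
      replace (‖x‖ * (/ ‖x‖ * ‖T x‖)) with (‖T x‖) in H2 by (field; trivial).
      split; lra.
Qed.

(** * Concatenating finite sets *)

Lemma nodup_separated {Z : NormedSpace} (A : list Z) :
  exists m, 0 < m /\ forall a b, In a A -> In b A -> a <> b -> m <= ‖a -v b‖.
Proof.
  induction A as [|a A (m & Hm & H)].
  - exists 1. split; [lra|intros ? ? []].
  - assert (exists m', 0 < m' /\ forall b, In b A -> a <> b -> m' <= ‖a -v b‖) as (m' & Hm' & H').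
    { clear m Hm H. induction A as [|b A (m & Hm & H)].
      - exists 1. split; [lra|intros ? []].
      - destruct (classic (a = b)) as [E|E].
        + exists m. split; trivial. intros b' [<-|Hb] Hne; [contradiction|auto].
        + exists (Rmin m (‖a -v b‖)). split.
          * apply Rmin_pos; trivial. destruct (ns_norm_nonneg _ (a -v b)) as [H0|H0]; trivial.
            exfalso. apply E. symmetry in H0. apply ns_norm_eq0 in H0.
            replace a with ((a -v b) +v b) by vring. rewrite H0. vring.
          * intros b' [<-|Hb] Hne; [apply Rmin_r|]. eapply Rle_trans; [apply Rmin_l|auto]. }
    exists (Rmin m m'). split; [now apply Rmin_pos|]. intros x y [<-|Hx] [<-|Hy] Hne.
    + now elim Hne.
    + eapply Rle_trans; [apply Rmin_r|auto].
    + rewrite norm_sub_sym. eapply Rle_trans; [apply Rmin_r|]. apply H'; auto.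
    + eapply Rle_trans; [apply Rmin_l|auto].
Qed.

Lemma list_norm_bound {Z : NormedSpace} (A : list Z) :
  exists r, 0 <= r /\ forall a, In a A -> ‖a‖ <= r.
Proof.
  exists (lsum A (fun a => ‖a‖)). split.
  - apply lsum_nonneg. intros; apply ns_norm_nonneg.
  - intros a Ha. apply (lsum_in_le A (fun a => ‖a‖)); trivial. intros; apply ns_norm_nonneg.
Qed.

Fixpoint running_max (d : nat -> R) (n : nat) : R :=
  match n with O => d O | S k => Rmax (running_max d k) (d (S k)) end.

Lemma running_max_ge d n : d n <= running_max d n.
Proof. destruct n; simpl; [lra|apply Rmax_r]. Qed.

Lemma running_max_mono d m n : (m <= n)%nat -> running_max d m <= running_max d n.
Proof. induction 1; [lra|]. eapply Rle_trans; [eassumption|]. simpl. apply Rmax_l. Qed.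

(* Rescaled copies of the finite sets [A p] are concatenated into one sequence [x]:
   [pc i] is the index of the copy containing [x i] and [off p] is the first index of copy [p]. *)
Lemma concatenation {Z : NormedSpace} (A : nat -> list Z) :
  (forall p, A p <> nil) -> (forall p, NoDup (A p)) ->
  exists (pc off : nat -> nat) (x : nat -> Z) (M D : nat -> R),
    (forall p i, (off p <= i)%nat <-> (p <= pc i)%nat) /\
    (forall p, (p <= off p)%nat) /\
    (forall i, exists a, In a (A (pc i)) /\ x i = M (pc i) *v a) /\
    (forall i j, i <> j -> pc i = pc j -> INR i + INR j + 1 <= ‖x i -v x j‖) /\
    (forall p q, (p <= q)%nat -> D p <= D q) /\
    (forall i, 2 * ‖x i‖ <= D (pc i)) /\ (forall i, 2 * (INR i + 1) <= D (pc i)) /\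
    (forall p, 0 < M p) /\
    (forall p a, In a (A p) -> exists i, pc i = p /\ x i = M p *v a).
Proof.
  intros Hne Hnd.
  set (off := fix off p := match p with O => O | S q => (off q + length (A q))%nat end).
  assert (Hlen : forall p, (1 <= length (A p))%nat).
  { intro p. specialize (Hne p). destruct (A p); [congruence|simpl; lia]. }
  assert (Hoffm : forall p q, (p <= q)%nat -> (off p <= off q)%nat).
  { intros p q H. induction H; trivial. simpl. lia. }
  assert (Hoff : forall p, (p <= off p)%nat).
  { induction p as [|p IH]; simpl; trivial. specialize (Hlen p). lia. }
  assert (Hpc : forall i, exists p, (off p <= i < off (S p))%nat).
  { intro i. induction i as [|i (p & Hp)].
    - exists O. specialize (Hlen O). simpl. lia.
    - destruct (le_lt_dec (off (S p)) (S i)) as [H|H].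
      + exists (S p). specialize (Hlen (S p)). simpl in *. lia.
      + exists p. lia. }
  apply choice in Hpc. destruct Hpc as (pc & Hpc).
  assert (Hpcu : forall p i, (off p <= i)%nat <-> (p <= pc i)%nat).
  { intros p i. specialize (Hpc i). split; intro H.
    - apply Nat.nlt_ge. intro Hlt. specialize (Hoffm (S (pc i)) p Hlt). lia.
    - specialize (Hoffm _ _ H). lia. }
  destruct (choice _ (fun p => nodup_separated (A p))) as (m & Hm).
  destruct (choice _ (fun p => list_norm_bound (A p))) as (r & Hr).
  (* All indices of copy [p] are below [off (S p)], so a separation of [2 off (S p)] exceeds the sum
     of any two of them. *)
  set (M := fun p => 2 * INR (off (S p)) / m p).
  assert (HM : forall p, 0 < M p).
  { intro p. apply Rdiv_lt_0_compat; [|apply Hm]. specialize (Hoff (S p)).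
    assert (0 < INR (off (S p))) by (apply lt_0_INR; lia). lra. }
  set (x := fun i => M (pc i) *v nth (i - off (pc i)) (A (pc i)) ns_zero).
  (* The running maximum makes [D] monotone; it dominates the diameters and the indices of all
     copies so far. *)
  set (D := running_max (fun p => Rmax (2 * (M p * r p)) (2 * INR (off (S p))))).
  assert (Hin : forall i, In (nth (i - off (pc i)) (A (pc i)) ns_zero) (A (pc i))).
  { intro i. apply nth_In. specialize (Hpc i). simpl in Hpc. lia. }
  exists pc, off, x, M, D.
  split; [trivial|split; [trivial|split; [|split; [|split; [|split; [|split; [|split]]]]]]]; trivial.
  - intro i. eexists. split; [apply Hin|reflexivity].
  - intros i j Hij Hp. unfold x. rewrite <- Hp.
    set (a := nth (i - off (pc i)) (A (pc i)) ns_zero).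
    set (b := nth (j - off (pc i)) (A (pc i)) ns_zero).
    assert (Hab : a <> b).
    { intro E. pose proof (Hpc i) as Hi. pose proof (Hpc j) as Hj. rewrite <- Hp in Hj. simpl in Hi, Hj.
      apply (NoDup_nth (A (pc i)) ns_zero) in E; trivial; lia. }
    replace (M (pc i) *v a -v M (pc i) *v b) with (M (pc i) *v (a -v b)) by vring.
    rewrite ns_norm_scal, Rabs_pos_eq by (left; apply HM).
    assert (Hab' : m (pc i) <= ‖a -v b‖).
    { apply Hm; trivial; [apply Hin|]. unfold b. rewrite Hp. apply Hin. }
    destruct (Hm (pc i)) as (Hm0 & _).
    apply Rle_trans with (M (pc i) * m (pc i)).
    + unfold M. replace (2 * INR (off (S (pc i))) / m (pc i) * m (pc i)) with
        (INR (off (S (pc i))) + INR (off (S (pc i)))) by (field; lra).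
      rewrite <- !plus_INR, <- S_INR. apply le_INR.
      pose proof (Hpc i) as Hi. pose proof (Hpc j) as Hj. rewrite <- Hp in Hj. lia.
    + apply Rmult_le_compat_l; trivial. left. apply HM.
  - intros p q. apply running_max_mono.
  - intro i. eapply Rle_trans; [|apply running_max_ge]. eapply Rle_trans; [|apply Rmax_l].
    unfold x. rewrite ns_norm_scal, Rabs_pos_eq by (left; apply HM).
    apply Rmult_le_compat_l; [lra|]. apply Rmult_le_compat_l; [left; apply HM|].
    apply Hr, Hin.
  - intro i. eapply Rle_trans; [|apply running_max_ge]. eapply Rle_trans; [|apply Rmax_r].
    apply Rmult_le_compat_l; [lra|]. rewrite <- S_INR. apply le_INR. apply Hpc.
  - intros p a Ha. destruct (In_nth _ _ ns_zero Ha) as (n & Hn & E).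
    exists (off p + n)%nat.
    assert (Hp : pc (off p + n)%nat = p).
    { apply Nat.le_antisymm.
      - apply Nat.nlt_ge. intro Hlt. apply Hpcu in Hlt. simpl in Hlt. lia.
      - apply Hpcu. lia. }
    split; trivial. unfold x. rewrite Hp. now replace (off p + n - off p)%nat with n by lia; rewrite E.
Qed.

(** * Walks *)

Section Walks.
Context {V : Type} (E : V -> V -> Prop).
Hypothesis E_sym : forall u v, E u v -> E v u.

Lemma walk_trans u v w m n : walk E u v m -> walk E v w n -> walk E u w (m + n).
Proof.
  induction 1; intro H'; [exact H'|]. simpl. econstructor; eauto.
Qed.

Lemma walk_rev u v n : walk E u v n -> walk E v u n.
Proof.
  induction 1; [constructor|]. replace (S n) with (n + 1)%nat by lia.
  eapply walk_trans; [eassumption|]. econstructor; [apply E_sym; eassumption|constructor].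
Qed.

Lemma walk_norm {X : NormedSpace} (f : V -> X) K u v n :
  (forall a b, E a b -> ‖f a -v f b‖ <= K) -> walk E u v n -> ‖f u -v f v‖ <= K * INR n.
Proof.
  intros HK. induction 1 as [v|u w v n Huw Hwv IH].
  - rewrite norm_sub_0. simpl. lra.
  - assert (‖f u -v f v‖ <= ‖f u -v f w‖ + ‖f w -v f v‖) by (apply norm_le_of_eq; vring).
    specialize (HK u w Huw). rewrite S_INR. lra.
Qed.

Lemma walk_real (f : V -> R) u v n :
  (forall a b, E a b -> f b <= f a + 1) -> walk E u v n -> f v <= f u + INR n.
Proof.
  intros HK. induction 1 as [v|u w v n Huw Hwv IH].
  - simpl. lra.
  - specialize (HK u w Huw). rewrite S_INR. lra.
Qed.

Definition within (u v : V) (r : R) : Prop := exists n, walk E u v n /\ INR n <= r.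

Lemma within_refl u r : 0 <= r -> within u u r.
Proof. exists O. split; [constructor|trivial]. Qed.

Lemma within_edge u v : E u v -> within u v 1.
Proof. exists 1%nat. split; [repeat econstructor; eauto|simpl; lra]. Qed.

Lemma within_trans u v w r s t : within u v r -> within v w s -> r + s <= t -> within u w t.
Proof.
  intros (m & Hm & Hr) (n & Hn & Hs) Ht. exists (m + n)%nat. split.
  - eapply walk_trans; eauto.
  - rewrite plus_INR. lra.
Qed.

Lemma within_sym u v r : within u v r -> within v u r.
Proof. intros (n & Hn & Hr). exists n. split; trivial. now apply walk_rev. Qed.

Lemma within_weaken u v r s : within u v r -> r <= s -> within u v s.
Proof. intros (n & Hn & Hr) H. exists n. split; trivial. lra. Qed.

Lemma within_graph_dist u v r : within u v r -> exists n, graph_dist E u v n /\ INR n <= r.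
Proof.
  intros (n & Hn & Hr).
  induction n as [n IH] using lt_wf_ind.
  destruct (classic (exists m, (m < n)%nat /\ walk E u v m)) as [(m & Hm & Hw)|Hno].
  - apply (IH m Hm Hw). apply lt_INR in Hm. lra.
  - exists n. split; trivial. split; trivial. intros m Hw. apply Nat.nlt_ge. intro Hlt.
    apply Hno. eauto.
Qed.

End Walks.

(** * The graph *)

Section Graph.
Context (l : nat -> nat -> nat).

(* The point [i] becomes the ray of the vertices [(i, j, 0)]; for [i <> j], a path of length
   [2 l i j + 1] joins the rays of [i] and [j], and [(i, j, s)] is its vertex at distance [s]
   from the ray of [i]. *)
Record vertex : Type := Vertex { vi : nat; vj : nat; vs : nat; vs_le : (vs <= l vi vj)%nat }.

(** The cases are an edge of a ray, an edge inside one half of a path, and the middle edge joining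
    the tips of the halves [(i, j)] and [(j, i)]. *)
Definition step (u v : vertex) : Prop :=
  (vi v = vi u /\ vj v = S (vj u) /\ vs u = O /\ vs v = O) \/
  (vi v = vi u /\ vj v = vj u /\ vs v = S (vs u)) \/
  (vi u <> vj u /\ vi v = vj u /\ vj v = vi u /\ vs u = l (vi u) (vj u) /\ vs v = l (vi v) (vj v)).

Definition edge (u v : vertex) : Prop := step u v \/ step v u.

Lemma edge_sym u v : edge u v -> edge v u.
Proof. unfold edge. tauto. Qed.

Lemma vertex_eq u v : vi u = vi v -> vj u = vj v -> vs u = vs v -> u = v.
Proof.
  destruct u as [i j s H], v as [i' j' s' H']; simpl. intros <- <- <-. f_equal. apply le_unique.
Qed.

Definition port (i j : nat) : vertex := Vertex i j 0 (Nat.le_0_l _).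

(** Total in [s], so that neighbours can be listed without checking that they exist; a height above
    [l i j] falls back to the port. *)
Definition mk (i j s : nat) : vertex :=
  match le_dec s (l i j) with left H => Vertex i j s H | right _ => port i j end.

Lemma mk_spec i j s : (s <= l i j)%nat -> vi (mk i j s) = i /\ vj (mk i j s) = j /\ vs (mk i j s) = s.
Proof. unfold mk. destruct (le_dec s (l i j)); [auto|contradiction]. Qed.

Lemma eq_mk u i j s : vi u = i -> vj u = j -> vs u = s -> u = mk i j s.
Proof.
  intros <- <- <-. destruct (mk_spec _ _ _ (vs_le u)) as (H1 & H2 & H3). now apply vertex_eq.
Qed.

Hypothesis l_pos : forall i j, i <> j -> (1 <= l i j)%nat.

Lemma edge_simple : simple_graph edge.
Proof.
  split; [exact edge_sym|]. intros [i j s H]. unfold edge, step; simpl. lia.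
Qed.

Lemma vertex_infinite : infinite_type vertex.
Proof. exists (port 0). intros i j H. now inversion H. Qed.

Lemma edge_degree : max_degree_3 edge.
Proof.
  split.
  - intro v.
    exists (if Nat.eq_dec (vs v) 0
      then mk (vi v) (pred (vj v)) 0 :: mk (vi v) (S (vj v)) 0 :: mk (vi v) (vj v) 1 :: nil
      else mk (vi v) (vj v) (pred (vs v)) :: mk (vi v) (vj v) (S (vs v)) ::
           mk (vj v) (vi v) (l (vj v) (vi v)) :: nil).
    split; [destruct (Nat.eq_dec (vs v) 0); simpl; lia|].
    intros w Hw.
    (* As [l] is positive off the diagonal, the tip of a half path never lies on a ray; otherwise a
       ray vertex could have a fourth neighbour. *)
    assert (Hc : forall u, vi u <> vj u -> vs u = l (vi u) (vj u) -> vs u <> O).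
    { intros u Hu E. specialize (l_pos _ _ Hu). lia. }
    destruct (Nat.eq_dec (vs v) 0) as [H0|H0]; unfold edge, step in Hw; simpl.
    + destruct Hw as [[(E1 & E2 & E3 & E4)|[(E1 & E2 & E3)|(E1 & E2 & E3 & E4 & E5)]]|
        [(E1 & E2 & E3 & E4)|[(E1 & E2 & E3)|(E1 & E2 & E3 & E4 & E5)]]].
      * right; left. symmetry. now apply eq_mk.
      * right; right; left. symmetry. apply eq_mk; trivial. lia.
      * exfalso. now apply (Hc v).
      * left. symmetry. apply eq_mk; trivial; [congruence|]. rewrite E2. trivial.
      * lia.
      * exfalso. apply (Hc v); trivial. congruence.
    + destruct Hw as [[(E1 & E2 & E3 & E4)|[(E1 & E2 & E3)|(E1 & E2 & E3 & E4 & E5)]]|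
        [(E1 & E2 & E3 & E4)|[(E1 & E2 & E3)|(E1 & E2 & E3 & E4 & E5)]]].
      * lia.
      * right; left. symmetry. now apply eq_mk.
      * right; right; left. symmetry. apply eq_mk; trivial. congruence.
      * lia.
      * left. symmetry. apply eq_mk; [congruence|congruence|lia].
      * right; right; left. symmetry. apply eq_mk; congruence.
  - exists (port 0 1), (port 0 0 :: port 0 2 :: mk 0 1 1 :: nil).
    destruct (mk_spec 0 1 1 (l_pos 0 1 ltac:(lia))) as (H1 & H2 & H3).
    split; trivial. split.
    + repeat constructor; simpl; intros H; repeat destruct H as [H|H]; trivial;
        try discriminate H; apply (f_equal vs) in H; rewrite H3 in H; discriminate H.
    + apply Forall_cons; [|apply Forall_cons; [|apply Forall_cons; [|apply Forall_nil]]];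
        unfold edge, step.
      * right. left. now repeat split.
      * left. left. now repeat split.
      * left. right. left. now repeat split.
Qed.

Lemma within_ray i j j' : within edge (port i j) (port i j') (Rabs (INR j - INR j')).
Proof.
  assert (H : forall n k, within edge (port i k) (port i (k + n)) (INR n)).
  { induction n as [|n IH]; intro k.
    - rewrite Nat.add_0_r. apply within_refl. simpl; lra.
    - eapply within_trans; [apply (IH k)|apply within_edge|rewrite S_INR; apply Rle_refl].
      left. left. simpl. lia. }
  destruct (le_dec j j') as [Hj|Hj].
  - replace j' with (j + (j' - j))%nat at 1 by lia. eapply within_weaken; [apply H|].
    rewrite minus_INR by trivial. rewrite Rabs_minus_sym. apply Rle_abs.
  - apply within_sym; [exact edge_sym|].
    replace j with (j' + (j - j'))%nat at 1 by lia. eapply within_weaken; [apply H|].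
    rewrite minus_INR by lia. apply Rle_abs.
Qed.

Lemma within_path u v : vi u = vi v -> vj u = vj v ->
  within edge u v (Rabs (INR (vs u) - INR (vs v))).
Proof.
  assert (H : forall n u v, vi u = vi v -> vj u = vj v -> vs v = (vs u + n)%nat ->
    within edge u v (INR n)).
  { induction n as [|n IH]; intros a b Hi Hj Hs.
    - replace b with a by (apply vertex_eq; trivial; lia). apply within_refl. simpl; lra.
    - pose proof (vs_le b) as Hb. rewrite <- Hi, <- Hj in Hb.
      destruct (mk_spec (vi a) (vj a) (vs a + n)) as (H1 & H2 & H3); [lia|].
      eapply within_trans; [apply (IH a (mk (vi a) (vj a) (vs a + n))); auto|apply within_edge|
        rewrite S_INR; apply Rle_refl].
      left. right. left. rewrite H1, H2, H3. lia. }
  intros Hi Hj. destruct (le_dec (vs u) (vs v)) as [Hs|Hs].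
  - eapply within_weaken; [apply (H (vs v - vs u)%nat); trivial; lia|].
    rewrite minus_INR by trivial. rewrite Rabs_minus_sym. apply Rle_abs.
  - apply within_sym; [exact edge_sym|].
    eapply within_weaken; [apply (H (vs u - vs v)%nat); auto; lia|].
    rewrite minus_INR by lia. apply Rle_abs.
Qed.

Lemma within_port u : within edge u (port (vi u) (vj u)) (INR (vs u)).
Proof.
  eapply within_weaken; [apply within_path; reflexivity|]. simpl.
  rewrite Rminus_0_r, Rabs_pos_eq; [lra|apply pos_INR].
Qed.

Hypothesis l_sym : forall i j, l i j = l j i.

Lemma within_cross u v : vi u <> vj u -> vi v = vj u -> vj v = vi u ->
  within edge u v (2 * INR (l (vi u) (vj u)) + 1 - INR (vs u) - INR (vs v)).
Proof.
  intros Hne Hi Hj. set (n := l (vi u) (vj u)).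
  pose proof (vs_le u) as Hu. pose proof (vs_le v) as Hv. fold n in Hu.
  rewrite Hi, Hj, l_sym in Hv. fold n in Hv.
  destruct (mk_spec (vi u) (vj u) n) as (H1 & H2 & H3); [reflexivity|].
  destruct (mk_spec (vj u) (vi u) n) as (H4 & H5 & H6); [unfold n; now rewrite l_sym|].
  set (a := mk (vi u) (vj u) n) in *. set (b := mk (vj u) (vi u) n) in *.
  assert (Hua : within edge u a (INR n - INR (vs u))).
  { eapply within_weaken; [now apply within_path|]. rewrite H3, Rabs_minus_sym, Rabs_pos_eq; [lra|].
    apply le_INR in Hu. lra. }
  assert (Hbv : within edge b v (INR n - INR (vs v))).
  { eapply within_weaken; [apply within_path; congruence|]. rewrite H6, Rabs_pos_eq; [lra|].
    apply le_INR in Hv. lra. }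
  assert (Hab : within edge a b 1).
  { apply within_edge. left. right. right. rewrite H1, H2, H3, H4, H5, H6.
    repeat split; trivial. unfold n. apply l_sym. }
  eapply within_trans; [exact Hua|eapply within_trans; [exact Hab|exact Hbv|apply Rle_refl]|lra].
Qed.

(** The path to [k] leaves the ray of [i] at the vertex with index [k], and symmetrically. The
    resulting terms [INR i] and [INR k] are later absorbed into the distance. *)
Lemma within_ports i j k m : i <> k ->
  within edge (port i j) (port k m) (INR j + INR m + INR i + INR k + 2 * INR (l i k) + 1).
Proof.
  intro Hik.
  assert (H : forall a b, Rabs (INR a - INR b) <= INR a + INR b).
  { intros a b. pose proof (pos_INR a). pose proof (pos_INR b). apply Rabs_le. lra. }
  eapply within_trans; [apply (within_ray i j k)|eapply within_trans;
    [apply (within_cross (port i k) (port k i)); trivial|apply (within_ray k i m)|apply Rle_refl]|].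
  simpl. specialize (H j k) as H1. specialize (H i m) as H2. lra.
Qed.

Lemma edge_connected : connected edge.
Proof.
  intros u v. enough (exists r, within edge u v r) as (r & n & Hn & _) by eauto.
  assert (exists r, within edge (port (vi u) (vj u)) (port (vi v) (vj v)) r) as (r & Hr).
  { destruct (Nat.eq_dec (vi u) (vi v)) as [E|E].
    - rewrite E. eexists. apply within_ray.
    - eexists. now apply within_ports. }
  eexists. eapply within_trans; [apply within_port|eapply within_trans;
    [exact Hr|apply within_sym; [exact edge_sym|apply within_port]|apply Rle_refl]|apply Rle_refl].
Qed.

(* Interpolating [rho] along the paths gives a function that changes by at most 1 along edges. *)
Lemma walk_length_ge (rho : nat -> R) i j n :
  (forall k m, rho k - rho m <= INR (l k m)) ->
  walk edge (port i 0) (port j 0) n -> rho j - rho i <= INR n.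
Proof.
  intros Hrho Hw.
  (* The two halves of a path give the same affine function since [l] is symmetric; its slope is at
     most [l / (2 l + 1)] in absolute value. *)
  set (F := fun v : vertex => rho (vi v) +
    INR (vs v) / (2 * INR (l (vi v) (vj v)) + 1) * (rho (vj v) - rho (vi v))).
  enough (H : F (port j 0) <= F (port i 0) + INR n).
  { unfold F in H. simpl in H. unfold Rdiv in H. rewrite !Rmult_0_l in H. lra. }
  assert (Hab : forall k m, Rabs (/ (2 * INR (l k m) + 1) * (rho m - rho k)) <= 1).
  { intros k m. pose proof (pos_INR (l k m)).
    assert (0 < / (2 * INR (l k m) + 1)) by (apply Rinv_0_lt_compat; lra).
    rewrite Rabs_mult, (Rabs_pos_eq (/ _)) by lra.
    apply Rmult_le_reg_l with (2 * INR (l k m) + 1); [lra|].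
    rewrite <- Rmult_assoc, Rinv_r by lra.
    assert (Rabs (rho m - rho k) <= INR (l k m)); [|lra].
    pose proof (Hrho k m). pose proof (Hrho m k) as H2. rewrite l_sym in H2. apply Rabs_le. lra. }
  assert (Hstep : forall u v, step u v -> Rabs (F v - F u) <= 1).
  { intros u v [(E1 & E2 & E3 & E4)|[(E1 & E2 & E3)|(E1 & E2 & E3 & E4 & E5)]]; unfold F.
    - rewrite E1, E3, E4. simpl. unfold Rdiv. rewrite !Rmult_0_l, Rminus_diag, Rabs_R0. lra.
    - rewrite E1, E2, E3, S_INR. eapply Rle_trans; [|apply (Hab (vi u) (vj u))]. right. f_equal.
      unfold Rdiv. ring.
    - rewrite E5, E4, E2, E3, (l_sym (vj u)).
      eapply Rle_trans; [|apply (Hab (vi u) (vj u))]. right. f_equal.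
      pose proof (pos_INR (l (vi u) (vj u))). field. lra. }
  apply (walk_real edge F _ _ n); trivial.
  intros a b [H|H]; apply Hstep in H; [|rewrite Rabs_minus_sym in H];
    pose proof (Rle_abs (F b - F a)); lra.
Qed.

End Graph.

(** * Embedding the graph *)

Lemma transversal_sequence {X : NormedSpace} (L : nat -> list X) :
  (forall k, dim_ge (fun _ : X => True) k) ->
  exists (u : nat -> X) (E : nat -> X -> Prop),
    (forall r, is_subspace (E r)) /\
    (forall r q x, (r <= q)%nat -> E r x -> E q x) /\
    (forall r x, In x (L r) -> E r x) /\
    (forall r, E (S r) (u r)) /\
    (forall r, ‖u r‖ = 1) /\
    (forall r y a, E r y -> Rabs a / 2 <= ‖y +v a *v u r‖).
Proof.
  intro Hdim.
  assert (Hsel : forall G : list X, exists u, ‖u‖ = 1 /\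
    forall y a, span G y -> Rabs a / 2 <= ‖y +v a *v u‖).
  { intro G. destruct (exists_outside_span G Hdim) as (v & Hv). exact (riesz G v Hv). }
  apply choice in Hsel. destruct Hsel as (sel & Hsel).
  set (G := fix G r := match r with O => L O | S q => sel (G q) :: L (S q) ++ G q end).
  exists (fun r => sel (G r)), (fun r => span (G r)).
  assert (Hin : forall r x, In x (G r) -> span (G r) x).
  { intros r x. apply span_mod_in, subspace_zero. }
  split; [|split; [|split; [|split; [|split]]]].
  - intro r. apply subspace_span.
  - intros r q x H. induction H as [|q H IH]; trivial. intro Hx.
    apply (span_min (span (G (S q))) (G q)); [apply subspace_span| |auto].
    apply Forall_forall. intros y Hy. apply Hin. simpl. right. apply in_or_app. now right.
  - intros r x Hx. apply Hin. destruct r; simpl; trivial. right. apply in_or_app. now left.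
  - intro r. apply Hin. now left.
  - intro r. apply Hsel.
  - intros r y a Hy. now apply Hsel.
Qed.

(** * Lower estimates for the embedding *)

Section Embedding.
Context {X : NormedSpace} (u : nat -> X) (E : nat -> X -> Prop).
Hypothesis E_sub : forall r, is_subspace (E r).
Hypothesis E_mono : forall r q x, (r <= q)%nat -> E r x -> E q x.
Hypothesis E_u : forall r, E (S r) (u r).
Hypothesis u_norm : forall r, ‖u r‖ = 1.
Hypothesis u_far : forall r y a, E r y -> Rabs a / 2 <= ‖y +v a *v u r‖.

Context (pc off : nat -> nat) (tx : nat -> X) (D : nat -> R) (delta : nat -> nat -> R)
  (l : nat -> nat -> nat) (c : R).
Hypothesis c_pos : 0 < c.
Hypothesis c_le : c <= 1.
Hypothesis off_pc : forall p i, (off p <= i)%nat <-> (p <= pc i)%nat.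
Hypothesis off_ge : forall p, (p <= off p)%nat.
Hypothesis D_mono : forall p q, (p <= q)%nat -> D p <= D q.
Hypothesis D_ge : forall i, 2 * (INR i + 1) <= D (pc i).
Hypothesis tx_norm : forall i, 2 * ‖tx i‖ <= D (pc i).
Hypothesis tx_E : forall i r, (pc i <= r)%nat -> E r (tx i).
Hypothesis delta_sym : forall i j, delta i j = delta j i.
Hypothesis delta_ge : forall i j, i <> j -> INR i + INR j + 1 <= delta i j.
Hypothesis delta_same : forall i j, i <> j -> pc i = pc j ->
  c * delta i j <= ‖tx i -v tx j‖ <= delta i j.
Hypothesis delta_diff : forall i j, (pc i < pc j)%nat -> delta i j = D (pc j).
Hypothesis delta_le : forall i j, (pc i <= pc j)%nat -> delta i j <= D (pc j).
Hypothesis l_sym : forall i j, l i j = l j i.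
Hypothesis l_diag : forall i, l i i = O.
Hypothesis l_delta : forall i j, i <> j -> delta i j <= INR (l i j) <= 2 * delta i j.

(* Slots of stage [j]: 0 for the direction separating the copies, 1 for the ray of [j] and
   [2 + i] for the path between [i < j] and [j]. *)
Let code (j s : nat) : nat := (S j * S j + s)%nat.
Let w (p : nat) : X := u (code (off p) 0).
Let g (i : nat) : X := u (code i 1).
Let ecode (i j : nat) : nat := code (max i j) (2 + min i j).
Let b (i j : nat) : X := u (ecode i j).
Let phi (i : nat) : X := tx i +v D (pc i) *v w (pc i).
Let P (i j : nat) : X := phi i +v INR j *v g i.
Let lam (i j : nat) : R := 2 * INR (l i j) + 1.
(** Each path is the segment between two ports, lifted like a tent: the height [s] rises along
    [b i j] in both halves, which share this direction because [ecode] is symmetric. *)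
Let f (i j s : nat) : X := P i j +v (INR s / lam i j) *v (P j i -v P i j) +v INR s *v b i j.

(** Consecutive squares differ here by [2 i + 3], which exceeds every slot of stage [i] in use. *)
Lemma code_lt_stage i j s : (i < j)%nat -> (s <= 2 + i)%nat -> forall t, (code i s < code j t)%nat.
Proof. intros H Hs t. unfold code. nia. Qed.

Lemma code_lt_slot j s t : (s < t)%nat -> (code j s < code j t)%nat.
Proof. unfold code. lia. Qed.

Lemma pc_mono i j : (i <= j)%nat -> (pc i <= pc j)%nat.
Proof. intro H. apply off_pc. pose proof (proj2 (off_pc (pc i) i) (le_n _)). lia. Qed.

(** The tool for removing the last direction: its coefficient costs a factor 2 and the remainder a
    factor 3. *)
Lemma far r y a : E r y -> Rabs a <= 2 * ‖y +v a *v u r‖ /\ ‖y‖ <= 3 * ‖y +v a *v u r‖.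
Proof.
  intro Hy. pose proof (u_far r y a Hy) as H.
  assert (‖y‖ <= ‖y +v a *v u r‖ + ‖(- a) *v u r‖) by (apply norm_le_of_eq; vring).
  rewrite ns_norm_scal, u_norm, Rabs_Ropp in H0. lra.
Qed.

Lemma far_sub r y a : E r y -> Rabs a <= 2 * ‖y -v a *v u r‖ /\ ‖y‖ <= 3 * ‖y -v a *v u r‖.
Proof.
  intro Hy. replace (y -v a *v u r) with (y +v (- a) *v u r) by vring.
  rewrite <- (Rabs_Ropp a). now apply far.
Qed.

Lemma E_add r x y : E r x -> E r y -> E r (x +v y).
Proof. apply E_sub. Qed.
Lemma E_scal r a x : E r x -> E r (a *v x).
Proof. apply E_sub. Qed.
Lemma E_diff r x y : E r x -> E r y -> E r (x -v y).
Proof. now apply subspace_sub. Qed.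
Lemma E_unit r q : (q < r)%nat -> E r (u q).
Proof. intro H. apply (E_mono (S q)); trivial. Qed.

Lemma E_tx i j s : (pc i <= pc j)%nat -> E (code j s) (tx i).
Proof.
  intro H. apply tx_E. pose proof (off_ge (pc j)).
  pose proof (proj2 (off_pc (pc j) j) (le_n _)). unfold code. nia.
Qed.

(** Slot 0 precedes the others, so the direction of a copy is available even at the stage of its
    first index. *)
Lemma E_phi i j s : (1 <= s)%nat -> (pc i <= pc j)%nat -> E (code j s) (phi i).
Proof.
  intros Hs H. unfold phi. apply E_add; [now apply E_tx|]. apply E_scal, E_unit.
  pose proof (proj2 (off_pc (pc i) j) H).
  destruct (Nat.eq_dec (off (pc i)) j) as [->|Hne].
  - now apply code_lt_slot.
  - apply code_lt_stage; lia.
Qed.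

Lemma E_P i j k s : (i < k)%nat \/ (i = k /\ (2 <= s)%nat) -> (1 <= s)%nat -> E (code k s) (P i j).
Proof.
  intros H Hs. unfold P. apply E_add.
  - apply E_phi; trivial. apply pc_mono. lia.
  - apply E_scal, E_unit. destruct H as [H|(-> & H)].
    + apply code_lt_stage; lia.
    + now apply code_lt_slot.
Qed.

Lemma E_P_ecode i j k m : (k <= max i j)%nat -> E (ecode i j) (P k m).
Proof. intro H. apply E_P; lia. Qed.

Lemma E_f i j s k t : (max i j < k)%nat \/ (max i j = k /\ (2 + min i j < t)%nat) -> E (code k t) (f i j s).
Proof.
  intro H. assert (Hc : (ecode i j < code k t)%nat).
  { destruct H as [H|(<- & H)]; [apply code_lt_stage; lia|now apply code_lt_slot]. }
  unfold f. apply E_add; [apply E_add; [|apply E_scal, E_diff]|apply E_scal, E_unit; trivial].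
  all: apply (E_mono (ecode i j)); [lia|apply E_P_ecode; lia].
Qed.

Lemma delta_pos i j : i <> j -> 1 <= delta i j.
Proof. intro H. pose proof (delta_ge i j H). pose proof (pos_INR i). pose proof (pos_INR j). lra. Qed.

Lemma D_pos i : 0 < D (pc i).
Proof. pose proof (D_ge i). pose proof (pos_INR i). lra. Qed.

Lemma phi_norm i : ‖phi i‖ <= 3 / 2 * D (pc i).
Proof.
  unfold phi. pose proof (ns_norm_triangle _ (tx i) (D (pc i) *v w (pc i))) as H.
  pose proof (D_pos i). rewrite ns_norm_scal, Rabs_pos_eq in H by lra.
  unfold w in H at 2. rewrite u_norm in H. pose proof (tx_norm i). lra.
Qed.

Lemma phi_diff i k : i <> k -> ‖phi i -v phi k‖ <= 3 * delta i k.
Proof.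
  assert (Hlt : forall i k, (pc i < pc k)%nat -> ‖phi i -v phi k‖ <= 3 * delta i k).
  { intros i' k' H. rewrite delta_diff by trivial. pose proof (norm_sub_le (phi i') (phi k')).
    pose proof (phi_norm i'). pose proof (phi_norm k').
    pose proof (D_mono (pc i') (pc k') ltac:(lia)). lra. }
  intro Hne. destruct (lt_eq_lt_dec (pc i) (pc k)) as [[H|H]|H].
  - now apply Hlt.
  - replace (phi i -v phi k) with (tx i -v tx k) by (unfold phi; rewrite H; vring).
    destruct (delta_same i k Hne H). pose proof (delta_pos i k Hne). lra.
  - rewrite norm_sub_sym, delta_sym. now apply Hlt.
Qed.

Lemma P_diff_le i j : ‖P i j -v P j i‖ <= 4 * INR (l i j).
Proof.
  destruct (Nat.eq_dec i j) as [<-|Hne].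
  - rewrite norm_sub_0, l_diag. simpl. lra.
  - assert (H : ‖P i j -v P j i‖ <= ‖phi i -v phi j‖ + ‖INR j *v g i -v INR i *v g j‖)
      by (apply norm_le_of_eq; unfold P; vring).
    pose proof (norm_sub_le (INR j *v g i) (INR i *v g j)) as H1.
    rewrite !ns_norm_scal in H1. unfold g in H1 at 3 4.
    rewrite !u_norm, !Rabs_pos_eq in H1 by apply pos_INR.
    pose proof (phi_diff i j Hne). pose proof (delta_ge i j Hne). pose proof (l_delta i j Hne). lra.
Qed.

Lemma lam_pos i j : 0 < lam i j.
Proof. unfold lam. pose proof (pos_INR (l i j)). lra. Qed.

Lemma interpolation_le i j s : ‖(INR s / lam i j) *v (P j i -v P i j)‖ <= 2 * INR s.
Proof.
  pose proof (lam_pos i j) as Hl. pose proof (pos_INR s) as Hs.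
  rewrite ns_norm_scal, norm_sub_sym, Rabs_pos_eq
    by (apply Rmult_le_pos; trivial; left; now apply Rinv_0_lt_compat).
  pose proof (P_diff_le i j) as H.
  apply Rle_trans with (INR s / lam i j * (2 * lam i j)); [|right; field; lra].
  apply Rmult_le_compat_l; [apply Rmult_le_pos; trivial; left; now apply Rinv_0_lt_compat|].
  unfold lam. lra.
Qed.

(** With [N] the norm on the right, removing [b i j] gives [s <= 2 N] and leaves a remainder of norm
    at most [3 N]; the interpolation term is at most [2 s <= 4 N]. In total 2 + 3 + 4 = 9. *)
Lemma path_point_far i j s y : E (ecode i j) y -> INR s + ‖y -v P i j‖ <= 9 * ‖y -v f i j s‖.
Proof.
  intro Hy. set (z := (INR s / lam i j) *v (P j i -v P i j)).
  destruct (far_sub (ecode i j) (y -v P i j -v z) (INR s)) as (H1 & H2).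
  { unfold z. apply E_diff; [apply E_diff; trivial|apply E_scal, E_diff]; apply E_P_ecode; lia. }
  replace (y -v P i j -v z -v INR s *v u (ecode i j)) with (y -v f i j s) in H1, H2
    by (unfold f, z, b; vring).
  rewrite Rabs_pos_eq in H1 by apply pos_INR.
  assert (‖y -v P i j‖ <= ‖y -v P i j -v z‖ + ‖z‖) by (apply norm_le_of_eq; vring).
  pose proof (interpolation_le i j s) as H3. fold z in H3. lra.
Qed.

(* [port_dist] is comparable to the graph distance between [(i, j, 0)] and [(k, m, 0)]. *)
Let port_dist (i j k m : nat) : R :=
  if Nat.eq_dec i k then Rabs (INR j - INR m) else INR j + INR m + delta i k.

Lemma scale_c N : 0 <= N -> N <= / c * N.
Proof.
  intro H. assert (1 <= / c) by (rewrite <- Rinv_1; apply Rinv_le_contravar; lra).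
  assert (1 * N <= / c * N) by (apply Rmult_le_compat_r; lra). lra.
Qed.

(** The ray of [k] is removed first. In the same copy the ray of [i] is next, and [delta_same]
    compares what is left with [delta]. In different copies it is the direction of the later copy,
    which gives [D (pc k) <= 6 N]; then [j <= 9 N + 2 D (pc k)], and 2 + 21 + 6 = 29. *)
Lemma ports_far_lt i j k m : (i < k)%nat ->
  INR j + INR m + delta i k <= 29 * (/ c * ‖P i j -v P k m‖).
Proof.
  intro Hik. set (N := ‖P i j -v P k m‖).
  assert (HN : 0 <= N) by apply ns_norm_nonneg. pose proof (scale_c N HN) as HcN.
  pose proof (pos_INR j) as Hj. pose proof (pos_INR m) as Hm.
  set (y := P i j -v phi k).
  destruct (far_sub (code k 1) y (INR m)) as (H1 & H2).
  { unfold y. apply E_diff; [apply E_P; lia|apply E_phi; lia]. }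
  replace (y -v INR m *v u (code k 1)) with (P i j -v P k m) in H1, H2
    by (unfold y, P, g; vring).
  fold N in H1, H2. rewrite Rabs_pos_eq in H1 by trivial.
  destruct (Nat.eq_dec (pc i) (pc k)) as [Hp|Hp].
  - destruct (far (code i 1) (phi i -v phi k) (INR j)) as (H3 & H4).
    { apply E_diff; apply E_phi; lia. }
    replace (phi i -v phi k +v INR j *v u (code i 1)) with y in H3, H4
      by (unfold y, P, g; vring).
    rewrite Rabs_pos_eq in H3 by trivial.
    replace (phi i -v phi k) with (tx i -v tx k) in H4 by (unfold phi; rewrite Hp; vring).
    destruct (delta_same i k ltac:(lia) Hp) as (H5 & _).
    assert (delta i k <= 9 * (/ c * N)); [|lra].
    apply Rmult_le_reg_l with c; trivial.
    replace (c * (9 * (/ c * N))) with (9 * N) by (field; lra). lra.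
  - assert (Hlt : (pc i < pc k)%nat) by (pose proof (pc_mono i k ltac:(lia)); lia).
    destruct (far_sub (code (off (pc k)) 0) (P i j -v tx k) (D (pc k))) as (H3 & H4).
    { apply E_diff.
      - assert (i < off (pc k))%nat by (apply Nat.nle_gt; rewrite off_pc; lia).
        apply (E_mono (code i 2)); [|apply E_P; lia]. apply Nat.lt_le_incl, code_lt_stage; lia.
      - apply tx_E. specialize (off_ge (pc k)). unfold code. nia. }
    replace (P i j -v tx k -v D (pc k) *v u (code (off (pc k)) 0)) with y in H3, H4
      by (unfold y, phi, w; vring).
    pose proof (D_pos k) as HD. rewrite Rabs_pos_eq in H3 by lra.
    rewrite (delta_diff i k Hlt).
    assert (H5 : ‖INR j *v g i‖ <= ‖P i j -v tx k‖ + ‖tx k -v phi i‖)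
      by (apply norm_le_of_eq; unfold P; vring).
    rewrite ns_norm_scal in H5. unfold g in H5. rewrite u_norm, Rabs_pos_eq in H5 by trivial.
    pose proof (norm_sub_le (tx k) (phi i)). pose proof (phi_norm i). pose proof (tx_norm k).
    pose proof (D_mono (pc i) (pc k) ltac:(lia)). lra.
Qed.

Lemma ports_far i j k m : port_dist i j k m <= 29 * (/ c * ‖P i j -v P k m‖).
Proof.
  unfold port_dist. destruct (Nat.eq_dec i k) as [<-|Hne].
  - replace (P i j -v P i m) with ((INR j - INR m) *v g i) by (unfold P; vring).
    rewrite ns_norm_scal. unfold g. rewrite u_norm, Rmult_1_r.
    pose proof (Rabs_pos (INR j - INR m)) as H. pose proof (scale_c _ H). lra.
  - destruct (le_lt_dec i k) as [H|H].
    + apply ports_far_lt. lia.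
    + rewrite norm_sub_sym, delta_sym. pose proof (ports_far_lt k m i j H). lra.
Qed.

Lemma port_path_far i j s k m : (s <= l i j)%nat ->
  INR s + port_dist i j k m <= 812 * (/ c * ‖f i j s -v P k m‖).
Proof.
  intro Hs. set (N := ‖f i j s -v P k m‖).
  assert (HN : 0 <= N) by apply ns_norm_nonneg. pose proof (scale_c N HN) as HcN.
  pose proof (pos_INR m) as Hm. pose proof (pos_INR s) as Hs0.
  assert (Hic : 0 < / c) by (now apply Rinv_0_lt_compat).
  destruct (le_lt_dec k (max i j)) as [Hk|Hk].
  - pose proof (path_point_far i j s (P k m) (E_P_ecode i j k m Hk)) as H1.
    rewrite (norm_sub_sym (P k m) (f i j s)) in H1. fold N in H1.
    pose proof (ports_far i j k m) as H2. rewrite norm_sub_sym in H2.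
    assert (/ c * ‖P k m -v P i j‖ <= / c * (9 * N)) by (apply Rmult_le_compat_l; lra).
    pose proof (ns_norm_nonneg _ (P k m -v P i j)). lra.
  - unfold port_dist. destruct (Nat.eq_dec i k) as [E'|Hne]; [lia|].
    set (y := f i j s -v phi k).
    destruct (far_sub (code k 1) y (INR m)) as (H1 & H2).
    { unfold y. apply E_diff; [apply E_f; lia|apply E_phi; lia]. }
    replace (y -v INR m *v u (code k 1)) with (f i j s -v P k m) in H1, H2
      by (unfold y, P, g; vring).
    fold N in H1, H2. rewrite Rabs_pos_eq in H1 by trivial.
    assert (Hpm : (pc (max i j) <= pc k)%nat) by (apply pc_mono; lia).
    destruct (Nat.eq_dec (pc (max i j)) (pc k)) as [Hp|Hp].
    (* Although [k] comes after both ends of the path, [phi k] uses only data of its copy, available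
       before the direction of the path. So that direction can be removed; this is the worst case,
       29 * 27 + 27 + 2 = 812. *)
    + assert (Hphi : E (ecode i j) (phi k)) by (apply E_phi; lia).
      pose proof (path_point_far i j s (phi k) Hphi) as H3.
      rewrite (norm_sub_sym (phi k) (f i j s)) in H3. fold y in H3.
      pose proof (ports_far i j k 0) as H4. unfold port_dist in H4.
      destruct (Nat.eq_dec i k) as [E'|_]; [lia|].
      replace (P k 0) with (phi k) in H4 by (unfold P; simpl; vring).
      rewrite norm_sub_sym in H4. simpl in H4.
      assert (/ c * ‖phi k -v P i j‖ <= / c * (27 * N)) by (apply Rmult_le_compat_l; lra).
      pose proof (ns_norm_nonneg _ (phi k -v P i j)). lra.
    (* The path belongs to earlier copies, so its length, its indices and the distance are bounded
       by multiples of [D (pc k)], which is at most [6 N]. *)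
    + destruct (far_sub (code (off (pc k)) 0) (f i j s -v tx k) (D (pc k))) as (H3 & _).
      { apply E_diff.
        - assert (max i j < off (pc k))%nat by (apply Nat.nle_gt; rewrite off_pc; lia).
          apply E_f. now left.
        - apply tx_E. specialize (off_ge (pc k)). unfold code. nia. }
      replace (f i j s -v tx k -v D (pc k) *v u (code (off (pc k)) 0)) with y in H3
        by (unfold y, phi, w; vring).
      pose proof (D_pos k) as HD. rewrite Rabs_pos_eq in H3 by lra.
      pose proof (pc_mono i (max i j) ltac:(lia)) as Hpi. pose proof (pc_mono j (max i j) ltac:(lia)) as Hpj.
      rewrite (delta_diff i k) by lia.
      pose proof (D_ge j) as HDj. pose proof (D_mono (pc j) (pc k) ltac:(lia)).
      pose proof (D_mono (pc i) (pc k) ltac:(lia)).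
      assert (INR s <= 2 * D (pc k)).
      { apply le_INR in Hs. destruct (Nat.eq_dec i j) as [<-|Hij].
        - rewrite l_diag in Hs. simpl in Hs. lra.
        - pose proof (l_delta i j Hij) as Hl.
          assert (delta i j <= D (pc k)); [|lra].
          destruct (le_lt_dec (pc i) (pc j)) as [H5|H5].
          + pose proof (delta_le i j H5). lra.
          + rewrite delta_sym. pose proof (delta_le j i ltac:(lia)). lra. }
      lra.
Qed.

(** The hypothesis on [max] and [min] orders the paths by [ecode], so the direction of the second is
    removed first; 7317 = 9 + 9 * 812. *)
Lemma paths_far i j s k m t : (s <= l i j)%nat -> (t <= l k m)%nat ->
  (max i j < max k m)%nat \/ (max i j = max k m /\ (min i j < min k m)%nat) ->
  INR s + INR t + port_dist i j k m <= 7317 * (/ c * ‖f i j s -v f k m t‖).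
Proof.
  intros Hs Ht Hlt. set (N := ‖f i j s -v f k m t‖).
  assert (HN : 0 <= N) by apply ns_norm_nonneg. pose proof (scale_c N HN) as HcN.
  assert (Hic : 0 < / c) by (now apply Rinv_0_lt_compat).
  assert (H1 : INR t + ‖f i j s -v P k m‖ <= 9 * N) by (apply path_point_far, E_f; lia).
  pose proof (port_path_far i j s k m Hs) as H2. pose proof (pos_INR t).
  assert (/ c * ‖f i j s -v P k m‖ <= / c * (9 * N)) by (apply Rmult_le_compat_l; lra).
  pose proof (ns_norm_nonneg _ (f i j s -v P k m)). lra.
Qed.

Definition embed (v : vertex l) : X := f (vi l v) (vj l v) (vs l v).

Lemma embed_step v v' : step l v v' -> ‖embed v -v embed v'‖ <= 3.
Proof.
  unfold embed. intros [(E1 & E2 & E3 & E4)|[(E1 & E2 & E3)|(E1 & E2 & E3 & E4 & E5)]].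
  - rewrite E1, E2, E3, E4, norm_sub_sym.
    set (i := vi l v). set (j := vj l v).
    replace (f i (S j) 0 -v f i j 0) with (g i).
    + unfold g. rewrite u_norm. lra.
    + unfold f, P. rewrite S_INR. simpl. vred; try (unfold Rdiv; ring).
  - rewrite E1, E2, E3, norm_sub_sym.
    set (i := vi l v). set (j := vj l v). set (s := vs l v).
    assert (H : ‖f i j (S s) -v f i j s‖ <= ‖(INR 1 / lam i j) *v (P j i -v P i j)‖ + ‖b i j‖).
    { apply norm_le_of_eq. unfold f. rewrite S_INR. simpl. unfold Rdiv. vring. }
    pose proof (interpolation_le i j 1) as H1. unfold b in H. rewrite u_norm in H. simpl in *. lra.
  - rewrite E5, E4, E2, E3. set (i := vi l v). set (j := vj l v).
    rewrite (l_sym j i).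
    pose proof (interpolation_le i j 1) as H1. simpl in H1.
    replace (f i j (l i j) -v f j i (l i j)) with (ns_opp ((1 / lam i j) *v (P j i -v P i j))).
    + rewrite norm_opp. lra.
    + unfold f, b, ecode. rewrite (Nat.max_comm j i), (Nat.min_comm j i).
      unfold lam. rewrite (l_sym j i).
      pose proof (pos_INR (l i j)). vred; field; lra.
Qed.

Lemma within_embed v v' :
  within (edge l) v v' (40000 * (/ c * ‖embed v -v embed v'‖)).
Proof.
  assert (Hic : 0 < / c) by (now apply Rinv_0_lt_compat).
  assert (Hlt : forall v v',
    let (i, j) := (vi l v, vj l v) in let (k, m) := (vi l v', vj l v') in
    (max i j < max k m)%nat \/ (max i j = max k m /\ (min i j < min k m)%nat) ->
    within (edge l) v v' (40000 * (/ c * ‖embed v -v embed v'‖))).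
  { clear v v'. intros v v' H. cbv zeta in H.
    pose proof (paths_far _ _ _ _ _ _ (vs_le l v) (vs_le l v') H) as H1.
    fold (embed v) (embed v') in H1. set (N := / c * ‖embed v -v embed v'‖) in *.
    assert (HN : 0 <= N) by (apply Rmult_le_pos; [lra|apply ns_norm_nonneg]).
    pose proof (pos_INR (vs l v)). pose proof (pos_INR (vs l v')).
    (* The factor 5: in [within_ports] the indices of the rays plus 1 are at most [delta], and
       [l <= 2 delta]. Then [5 * 7317 <= 40000]. *)
    assert (Hp : within (edge l) (port l (vi l v) (vj l v)) (port l (vi l v') (vj l v'))
      (5 * port_dist (vi l v) (vj l v) (vi l v') (vj l v'))).
    { unfold port_dist. destruct (Nat.eq_dec (vi l v) (vi l v')) as [E'|E'].
      - rewrite E'. eapply within_weaken; [apply within_ray|].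
        pose proof (Rabs_pos (INR (vj l v) - INR (vj l v'))). lra.
      - eapply within_weaken; [apply within_ports; trivial|].
        pose proof (delta_ge _ _ E'). pose proof (l_delta _ _ E').
        pose proof (pos_INR (vj l v)). pose proof (pos_INR (vj l v')). lra. }
    eapply within_trans; [apply within_port|eapply within_trans;
      [exact Hp|apply within_sym; [apply edge_sym|apply within_port]|apply Rle_refl]|].
    lra. }
  destruct (Nat.eq_dec (max (vi l v) (vj l v)) (max (vi l v') (vj l v'))) as [HM|HM].
  2:{ destruct (le_lt_dec (max (vi l v) (vj l v)) (max (vi l v') (vj l v'))).
      - apply Hlt. left. lia.
      - rewrite norm_sub_sym. apply within_sym; [apply edge_sym|]. apply Hlt. now left. }
  destruct (Nat.eq_dec (min (vi l v) (vj l v)) (min (vi l v') (vj l v'))) as [Hm|Hm].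
  2:{ destruct (le_lt_dec (min (vi l v) (vj l v)) (min (vi l v') (vj l v'))).
      - apply Hlt. right. lia.
      - rewrite norm_sub_sym. apply within_sym; [apply edge_sym|]. apply Hlt. right. lia. }
  (* With equal [max] and [min], the vertices lie on one path, in the same half or in opposite
     halves. *)
  assert (H : (vi l v = vi l v' /\ vj l v = vj l v') \/
    (vi l v <> vj l v /\ vi l v' = vj l v /\ vj l v' = vi l v)) by lia.
  unfold embed. destruct H as [(Hi & Hj)|(Hne & Hi & Hj)].
  - eapply within_weaken; [now apply within_path|]. rewrite <- Hi, <- Hj.
    set (i := vi l v). set (j := vj l v). set (s := vs l v). set (t := vs l v').
    destruct (far (ecode i j) (((INR s - INR t) / lam i j) *v (P j i -v P i j)) (INR s - INR t))
      as (H1 & _).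
    { apply E_scal, E_diff; apply E_P_ecode; lia. }
    replace (((INR s - INR t) / lam i j) *v (P j i -v P i j) +v (INR s - INR t) *v u (ecode i j))
      with (f i j s -v f i j t) in H1 by (unfold f, b; vred; unfold Rdiv; ring).
    pose proof (scale_c (‖f i j s -v f i j t‖) (ns_norm_nonneg _ _)).
    pose proof (ns_norm_nonneg _ (f i j s -v f i j t)). lra.
  - eapply within_weaken; [now apply within_cross|]. rewrite Hi, Hj.
    pose proof (vs_le l v) as Hs. pose proof (vs_le l v') as Ht. rewrite Hi, Hj in Ht.
    set (i := vi l v) in *. set (j := vj l v) in *. set (s := vs l v) in *. set (t := vs l v') in *.
    rewrite (l_sym j i) in Ht. apply le_INR in Hs. apply le_INR in Ht.
    set (N := ‖f i j s -v f j i t‖).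
    destruct (far (ecode i j) ((1 - (INR s + INR t) / lam i j) *v (P i j -v P j i)) (INR s - INR t))
      as (_ & H2).
    { apply E_scal, E_diff; apply E_P_ecode; lia. }
    pose proof (lam_pos i j) as Hlam.
    replace ((1 - (INR s + INR t) / lam i j) *v (P i j -v P j i) +v (INR s - INR t) *v u (ecode i j))
      with (f i j s -v f j i t) in H2.
    2:{ unfold f, b, ecode. rewrite (Nat.max_comm j i), (Nat.min_comm j i).
        unfold lam in *. rewrite (l_sym j i). vred; field; lra. }
    fold N in H2. rewrite ns_norm_scal in H2.
    (* [q] is the fraction of the path between the two points, so [q * lam i j] is their distance
       along it. The heights nearly cancel here, and the separation comes from the segment between
       the ports. *)
    set (q := 1 - (INR s + INR t) / lam i j) in *.
    assert (Hq : q * lam i j = 2 * INR (l i j) + 1 - INR s - INR t) by (unfold q, lam in *; field; lra).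
    assert (Hq0 : 0 <= q).
    { apply Rmult_le_reg_r with (lam i j); trivial. lra. }
    rewrite Rabs_pos_eq in H2 by trivial. rewrite <- Hq.
    pose proof (ports_far i j j i) as H3. unfold port_dist in H3.
    destruct (Nat.eq_dec i j) as [E'|_]; [contradiction|].
    pose proof (l_delta i j Hne) as Hl. pose proof (delta_pos i j Hne) as Hd.
    pose proof (pos_INR i) as Hi0. pose proof (pos_INR j) as Hj0.
    assert (H4 : lam i j <= 174 * (/ c * ‖P i j -v P j i‖)) by (unfold lam; lra).
    apply Rmult_le_compat_l with (r := q) in H4; trivial.
    assert (H5 : / c * (q * ‖P i j -v P j i‖) <= / c * (3 * N)) by (apply Rmult_le_compat_l; lra).
    assert (HN : 0 <= N) by apply ns_norm_nonneg. pose proof (scale_c N HN). lra.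
Qed.

Lemma graph_embeds : bilip_embed (edge l) X.
Proof.
  assert (Hic : 0 < / c) by (now apply Rinv_0_lt_compat).
  exists embed, (c / 40000), (3 * (40000 / c)). split; [lra|].
  intros v v' n (Hw & Hmin). split.
  - destruct (within_embed v v') as (m & Hm & Hle). apply Hmin, le_INR in Hm.
    apply Rmult_le_reg_l with (40000 * / c); [lra|].
    replace (40000 * / c * (c / 40000 * INR n)) with (INR n) by (field; lra). lra.
  - replace (c / 40000 * (3 * (40000 / c)) * INR n) with (3 * INR n) by (field; lra).
    apply (walk_norm (edge l)); trivial. intros a a' [H|H]; [|rewrite norm_sub_sym]; now apply embed_step.
Qed.

End Embedding.

(** * Linear embeddings and test sets *)

Lemma normalized_embedding {Z X : NormedSpace} (S : Z -> Prop) (T : Z -> X) a b C :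
  linear_on S T -> 0 <= a -> 0 <= b -> a * b <= C -> 1 <= C ->
  (forall x, S x -> ‖T x‖ <= b * ‖x‖) -> (forall x, S x -> ‖x‖ <= a * ‖T x‖) ->
  exists T' : Z -> X, linear_on S T' /\ forall x, S x -> / C * ‖x‖ <= ‖T' x‖ <= ‖x‖.
Proof.
  intros (Hadd & Hscal) Ha Hb Hab HC Hup Hlow.
  assert (HC1 : / C <= 1) by (rewrite <- Rinv_1; apply Rinv_le_contravar; lra).
  assert (HC0 : 0 < / C) by (apply Rinv_0_lt_compat; lra).
  destruct Hb as [Hb|<-].
  - exists (fun x => / b *v T x). split; [split|].
    + intros x y Hx Hy. rewrite Hadd by trivial. vring.
    + intros c x Hx Hcx. rewrite Hscal by trivial. vring.
    + intros x Hx. specialize (Hup x Hx). specialize (Hlow x Hx).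
      rewrite ns_norm_scal, Rabs_pos_eq by (left; now apply Rinv_0_lt_compat).
      pose proof (ns_norm_nonneg _ (T x)).
      assert (Hn : ‖T x‖ = b * (/ b * ‖T x‖)) by (field; lra).
      set (t := / b * ‖T x‖) in *. split.
      * apply Rmult_le_reg_l with C; [lra|]. rewrite <- Rmult_assoc, Rinv_r, Rmult_1_l by lra.
        rewrite Hn, <- Rmult_assoc in Hlow. eapply Rle_trans; [exact Hlow|].
        apply Rmult_le_compat_r; trivial. apply Rmult_le_pos; trivial.
        left. now apply Rinv_0_lt_compat.
      * apply Rmult_le_reg_l with b; trivial. lra.
  (* If [b = 0], every vector of [S] has norm 0 and [T] itself will do. *)
  - exists T. split; [now split|]. intros x Hx. specialize (Hup x Hx). specialize (Hlow x Hx).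
    pose proof (ns_norm_nonneg _ (T x)). pose proof (ns_norm_nonneg _ x).
    assert (H1 : ‖T x‖ = 0) by lra. rewrite H1 in *.
    assert (H2 : ‖x‖ = 0) by lra. rewrite H2. lra.
Qed.

Lemma dim_ge_image {Z X : NormedSpace} (S : Z -> Prop) (T : Z -> X) c k :
  is_subspace S -> linear_on S T -> 0 < c -> (forall x, S x -> c * ‖x‖ <= ‖T x‖) ->
  dim_ge S k -> dim_ge (fun _ : X => True) k.
Proof.
  intros HS HT Hc Hlow (vs & Hl & Hvs & Hi). exists (map T vs).
  split; [now rewrite length_map|]. split; [now apply Forall_forall|].
  intros cs Hcs H0. rewrite length_map in Hcs. apply Hi; trivial.
  assert (H : forall cs vs, length cs = length vs -> Forall S vs ->
    S (lincomb (combine cs vs)) /\ T (lincomb (combine cs vs)) = lincomb (combine cs (map T vs))).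
  { clear - HS HT. intros cs vs. revert cs. induction vs as [|v vs IH]; intros [|a cs] Hl Hvs;
      try discriminate; simpl.
    - split; [apply HS|]. now apply (linear_on_zero S).
    - inversion Hvs as [|? ? Hv Hvs']; subst.
      destruct (IH cs ltac:(now injection Hl) Hvs') as (H1 & H2).
      assert (S (a *v v)) by now apply HS.
      split; [now apply HS|]. rewrite <- H2. destruct HT as (Hta & Hts). now rewrite Hta, Hts. }
  destruct (H cs vs Hcs Hvs) as (H1 & H2). rewrite H0 in H2.
  apply ns_norm_eq0. specialize (Hlow _ H1). rewrite H2, norm_0 in Hlow.
  pose proof (ns_norm_nonneg _ (lincomb (combine cs vs))) as [H3|H3]; [|now symmetry].
  assert (0 < c * ‖lincomb (combine cs vs)‖) by now apply Rmult_lt_0_compat. lra.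
Qed.

(** * Path lengths of the graph *)

Section Lengths.
Context {Z : NormedSpace} (pc : nat -> nat) (x : nat -> Z) (D : nat -> R).
Hypothesis x_sep : forall i j, i <> j -> pc i = pc j -> INR i + INR j + 1 <= ‖x i -v x j‖.
Hypothesis D_mono : forall p q, (p <= q)%nat -> D p <= D q.
Hypothesis x_norm : forall i, 2 * ‖x i‖ <= D (pc i).
Hypothesis D_ge : forall i, 2 * (INR i + 1) <= D (pc i).

(** The distance to be realized by the ports [(i, 0)]. Between copies it is the larger [D], at least
    the diameter of either copy, so a detour through another copy is never a shortcut. *)
Definition delta (i j : nat) : R :=
  if Nat.eq_dec (pc i) (pc j) then ‖x i -v x j‖ else D (max (pc i) (pc j)).

Definition path_length (i j : nat) : nat :=
  if Nat.eq_dec i j then O else Z.to_nat (up (delta i j)).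

Lemma delta_sym i j : delta i j = delta j i.
Proof.
  unfold delta. rewrite norm_sub_sym, Nat.max_comm.
  destruct (Nat.eq_dec (pc i) (pc j)), (Nat.eq_dec (pc j) (pc i)); trivial; congruence.
Qed.

Lemma delta_ge i j : i <> j -> INR i + INR j + 1 <= delta i j.
Proof.
  intro H. unfold delta. destruct (Nat.eq_dec (pc i) (pc j)) as [E|E]; [auto|].
  pose proof (D_ge i). pose proof (D_ge j). pose proof (pos_INR i). pose proof (pos_INR j).
  pose proof (D_mono (pc i) (max (pc i) (pc j)) ltac:(lia)).
  pose proof (D_mono (pc j) (max (pc i) (pc j)) ltac:(lia)). lra.
Qed.

Lemma delta_diff i j : (pc i < pc j)%nat -> delta i j = D (pc j).
Proof.
  intro H. unfold delta. destruct (Nat.eq_dec (pc i) (pc j)); [lia|]. f_equal. lia.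
Qed.

Lemma delta_le i j : (pc i <= pc j)%nat -> delta i j <= D (pc j).
Proof.
  intro H. unfold delta. destruct (Nat.eq_dec (pc i) (pc j)) as [E|E].
  - pose proof (norm_sub_le (x i) (x j)). pose proof (x_norm i). pose proof (x_norm j).
    rewrite E in *. lra.
  - apply D_mono. lia.
Qed.

Lemma path_length_sym i j : path_length i j = path_length j i.
Proof.
  unfold path_length. rewrite delta_sym.
  destruct (Nat.eq_dec i j), (Nat.eq_dec j i); trivial; congruence.
Qed.

Lemma path_length_diag i : path_length i i = O.
Proof. unfold path_length. destruct (Nat.eq_dec i i); congruence. Qed.

Lemma path_length_delta i j : i <> j -> delta i j <= INR (path_length i j) <= 2 * delta i j.
Proof.
  intro H. pose proof (delta_ge i j H). pose proof (pos_INR i). pose proof (pos_INR j).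
  unfold path_length. destruct (Nat.eq_dec i j) as [E|_]; [contradiction|].
  destruct (archimed (delta i j)) as (H3 & H4).
  rewrite INR_IZR_INZ, Z2Nat.id; [lra|]. apply le_IZR. lra.
Qed.

Lemma path_length_pos i j : i <> j -> (1 <= path_length i j)%nat.
Proof.
  intro H. pose proof (delta_ge i j H). pose proof (pos_INR i). pose proof (pos_INR j).
  pose proof (path_length_delta i j H). apply INR_le. simpl. lra.
Qed.

(* Two points outside copy [pc i] get the same value, and a path leaving that copy is at
   least as long as the diameter of the copy. *)
Lemma delta_le_walk i j n : i <> j -> pc i = pc j ->
  walk (edge path_length) (port path_length i 0) (port path_length j 0) n -> delta i j <= INR n.
Proof.
  intros Hij Hp Hw.
  set (rho := fun k => if Nat.eq_dec (pc k) (pc i) then ‖x i -v x k‖ else 0).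
  assert (Hrho : forall k m, rho k - rho m <= INR (path_length k m)).
  { intros k m. destruct (Nat.eq_dec k m) as [<-|Hkm].
    { rewrite path_length_diag. simpl. lra. }
    pose proof (path_length_delta k m Hkm) as Hl. unfold rho.
    destruct (Nat.eq_dec (pc k) (pc i)) as [Hk|Hk], (Nat.eq_dec (pc m) (pc i)) as [Hm|Hm].
    - unfold delta in Hl. destruct (Nat.eq_dec (pc k) (pc m)); [|congruence].
      assert (‖x i -v x k‖ <= ‖x i -v x m‖ + ‖ns_opp (x k -v x m)‖) by (apply norm_le_of_eq; vring).
      rewrite norm_opp in *. lra.
    - unfold delta in Hl. destruct (Nat.eq_dec (pc k) (pc m)); [congruence|].
      pose proof (norm_sub_le (x i) (x k)). pose proof (x_norm i). pose proof (x_norm k).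
      rewrite Hk in *. pose proof (D_mono (pc i) (max (pc i) (pc m)) ltac:(lia)). lra.
    - pose proof (ns_norm_nonneg _ (x i -v x m)). pose proof (pos_INR (path_length k m)). lra.
    - pose proof (pos_INR (path_length k m)). lra. }
  pose proof (walk_length_ge path_length path_length_sym rho i j n Hrho Hw) as H.
  unfold rho in H. destruct (Nat.eq_dec (pc j) (pc i)); [|congruence].
  destruct (Nat.eq_dec (pc i) (pc i)); [|congruence]. rewrite norm_sub_0 in H.
  unfold delta. destruct (Nat.eq_dec (pc i) (pc j)); [lra|congruence].
Qed.

Lemma within_delta i j : i <> j ->
  within (edge path_length) (port path_length i 0) (port path_length j 0) (5 * delta i j).
Proof.
  intro H. eapply within_weaken; [apply within_ports; trivial; apply path_length_sym|].
  pose proof (delta_ge i j H). pose proof (path_length_delta i j H). simpl. lra.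
Qed.

End Lengths.

(** * The equivalence *)

Theorem theorem4p1 :
  forall (Z : NormedSpace) (Xs : nat -> Z -> Prop),
    (forall n, is_subspace (Xs n)) ->
    (forall n, finite_dim (Xs n)) ->
    (forall n x, Xs n x -> Xs (S n) x) ->
    (forall k, exists N, forall n, (N <= n)%nat -> dim_ge (Xs n) k) ->
    exists (V : Type) (E : V -> V -> Prop),
      simple_graph E /\ infinite_type V /\ connected E /\ max_degree_3 E /\
      forall X : BanachSpace, bilip_embed E X <-> unif_iso_embed Xs X.
Proof.
  intros Z Xs Hsub Hfd _ Hdim.
  assert (HA : forall p, exists A : list Z, A <> nil /\ NoDup A /\
    Forall (Xs (fst (Cantor.of_nat p))) A /\
    forall (X : NormedSpace) (f : Z -> X),
      (forall x y, In x A -> In y A -> ‖x -v y‖ <= ‖f x -v f y‖ <=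
         (INR (snd (Cantor.of_nat p)) + 1) * ‖x -v y‖) ->
      exists T : Z -> X, linear_on (Xs (fst (Cantor.of_nat p))) T /\
        forall x, Xs (fst (Cantor.of_nat p)) x ->
          ‖x‖ <= 2 * ‖T x‖ /\ ‖T x‖ <= 3 * (INR (snd (Cantor.of_nat p)) + 1) * ‖x‖).
  { intro p. apply discretization; trivial. pose proof (pos_INR (snd (Cantor.of_nat p))). lra. }
  apply choice in HA. destruct HA as (A & HA).
  destruct (concatenation A) as (pc & off & x & M & D & Hoff & Hoffge & Hx & Hsep & HDm & Hxn & HDge
    & HM & HAx); [apply HA|apply HA|].
  set (l := path_length pc x D).
  pose proof (path_length_diag pc x D) as Hld. fold l in Hld.
  pose proof (path_length_sym pc x D) as Hls. fold l in Hls.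
  pose proof (path_length_pos pc x D Hsep HDm HDge) as Hlp. fold l in Hlp.
  exists (vertex l), (edge l).
  split; [apply edge_simple|]. split; [apply vertex_infinite|].
  split; [apply edge_connected; trivial|]. split; [apply edge_degree; trivial|].
  intro X. split.
  - intros (F & r & C & Hr & HF).
    (* On the ports of one copy the graph distance exceeds the norm distance by at most a factor 5,
       so a suitable multiple of [F] has distortion at most [5 C] there. The pair [(n, d)] selects
       the copy, with [d] the same for all [n]. *)
    destruct (exists_nat_ge (5 * C)) as (d & Hd).
    exists (2 * (3 * (INR d + 1))). intro n.
    set (p := Cantor.to_nat (n, d)).
    destruct (HA p) as (_ & _ & _ & Htest). specialize (HAx p).
    unfold p in Htest. rewrite Cantor.cancel_of_to in Htest. simpl in Htest. fold p in Htest.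
    (* Outside [A p] the index is arbitrary, here 0. *)
    assert (Hidx : exists idx : Z -> nat, forall a, In a (A p) -> pc (idx a) = p /\ x (idx a) = M p *v a).
    { apply (choice (fun a i => In a (A p) -> pc i = p /\ x i = M p *v a)). intro a.
      destruct (classic (In a (A p))) as [Ha|Ha]; [destruct (HAx a Ha) as (i & Hi); now exists i|].
      exists O. tauto. }
    destruct Hidx as (idx & Hidx).
    specialize (HM p).
    assert (HrM : 0 < r * M p) by now apply Rmult_lt_0_compat.
    (* Dividing by [r * M p] undoes the rescaling of the copy and makes the lower constant 1. *)
    destruct (Htest X (fun a => / (r * M p) *v F (port l (idx a) 0))) as (T & HT & HTb).
    + intros a b Ha Hb. destruct (Hidx a Ha) as (Hpa & Hxa). destruct (Hidx b Hb) as (Hpb & Hxb).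
      destruct (Nat.eq_dec (idx a) (idx b)) as [Hab|Hab].
      { assert (a = b) as <-.
        { rewrite Hab, Hxb in Hxa.
          rewrite <- (ns_scal_1 _ a), <- (ns_scal_1 _ b), <- (Rinv_l (M p)), <- !ns_scal_assoc by lra.
          now rewrite Hxa. }
        rewrite !norm_sub_0. lra. }
      destruct (within_graph_dist (edge l) _ _ _ (within_delta pc x D Hsep HDm HDge _ _ Hab))
        as (m & Hm & Hle).
      pose proof (delta_le_walk pc x D Hsep HDm Hxn HDge _ _ m Hab ltac:(congruence) (proj1 Hm)) as Hge.
      assert (Hdel : delta pc x D (idx a) (idx b) = M p * ‖a -v b‖).
      { unfold delta. destruct (Nat.eq_dec (pc (idx a)) (pc (idx b))); [|congruence].
        rewrite Hxa, Hxb. replace (M p *v a -v M p *v b) with (M p *v (a -v b)) by vring.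
        rewrite ns_norm_scal, Rabs_pos_eq by lra. trivial. }
      rewrite Hdel in Hle, Hge. destruct (HF _ _ _ Hm) as (H1 & H2).
      set (N := ‖F (port l (idx a) 0) -v F (port l (idx b) 0)‖) in *.
      replace (/ (r * M p) *v F (port l (idx a) 0) -v / (r * M p) *v F (port l (idx b) 0))
        with (/ (r * M p) *v (F (port l (idx a) 0) -v F (port l (idx b) 0))) by vring.
      rewrite ns_norm_scal, Rabs_pos_eq by (left; now apply Rinv_0_lt_compat). fold N.
      assert (Hab0 : 0 < ‖a -v b‖).
      { assert (0 < delta pc x D (idx a) (idx b)).
        { pose proof (delta_ge pc x D Hsep HDm HDge _ _ Hab). pose proof (pos_INR (idx a)).
          pose proof (pos_INR (idx b)). lra. }
        rewrite Hdel in H. apply Rmult_lt_reg_l with (M p); trivial. lra. }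
      assert (Hm0 : 0 < INR m).
      { assert (0 < M p * ‖a -v b‖) by now apply Rmult_lt_0_compat. lra. }
      split; apply Rmult_le_reg_l with (r * M p); trivial;
        [|rewrite <- (Rmult_assoc (r * M p) (/ _)), Rinv_r, Rmult_1_l by lra];
        [rewrite <- (Rmult_assoc (r * M p) (/ _)), Rinv_r, Rmult_1_l by lra|].
      * apply Rle_trans with (r * INR m); trivial. rewrite Rmult_assoc.
        apply Rmult_le_compat_l; lra.
      * assert (HC : 0 <= C).
        { apply Rmult_le_reg_r with (r * INR m); [now apply Rmult_lt_0_compat|].
          assert (0 <= r * INR m) by (apply Rmult_le_pos; lra). lra. }
        apply Rle_trans with (r * C * (5 * (M p * ‖a -v b‖))).
        -- eapply Rle_trans; [exact H2|]. apply Rmult_le_compat_l; trivial. apply Rmult_le_pos; lra.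
        -- replace (r * C * (5 * (M p * ‖a -v b‖))) with (r * M p * (5 * C * ‖a -v b‖)) by ring.
           apply Rmult_le_compat_l; [lra|]. apply Rmult_le_compat_r; lra.
    + pose proof (pos_INR d).
      exists T, 2, (3 * (INR d + 1)). split; trivial. split; [lra|]. split; [lra|]. split; [lra|].
      split; intros y Hy; now apply HTb.
  - intros (C0 & HC0). set (C := Rmax C0 1).
    assert (HC1 : 1 <= C) by apply Rmax_r. assert (HC0C : C0 <= C) by apply Rmax_l.
    assert (HT : forall n, exists T : Z -> X, linear_on (Xs n) T /\
      forall y, Xs n y -> / C * ‖y‖ <= ‖T y‖ <= ‖y‖).
    { intro n. destruct (HC0 n) as (T & a & b & HT & Ha & Hb & Hab & Hup & Hlow).
      apply (normalized_embedding (Xs n) T a b C); trivial. lra. }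
    apply choice in HT. destruct HT as (T & HT).
    assert (Hc : 0 < / C) by (apply Rinv_0_lt_compat; lra).
    assert (Hc1 : / C <= 1) by (rewrite <- Rinv_1; apply Rinv_le_contravar; lra).
    assert (HdimX : forall k, dim_ge (fun _ : X => True) k).
    { intro k. destruct (Hdim k) as (N & HN).
      apply (dim_ge_image (Xs N) (T N) (/ C)); trivial; [apply HT| |now apply HN].
      intros y Hy. now apply HT. }
    set (T' := fun p => T (fst (Cantor.of_nat p))).
    set (tx := fun i => T' (pc i) (x i)).
    assert (HXx : forall i, Xs (fst (Cantor.of_nat (pc i))) (x i)).
    { intro i. destruct (Hx i) as (a & Ha & ->). apply Hsub.
      destruct (HA (pc i)) as (_ & _ & HF & _). now apply (proj1 (Forall_forall _ _) HF). }
    (* The list at stage [p] is the image of [A p], so [E r] contains the images of all copies up to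
       [r]. *)
    destruct (transversal_sequence (fun p => map (T' p) (A p)) HdimX)
      as (u & E & HE & HEm & HEL & HEu & Hu & Hfar).
    apply (graph_embeds u E HE HEm HEu Hu Hfar pc off tx D (delta pc x D) l (/ C)); trivial.
    + intro i. destruct (HT (fst (Cantor.of_nat (pc i)))) as (_ & Hn).
      specialize (Hn (x i) (HXx i)). specialize (Hxn i). unfold tx, T'. lra.
    + intros i r Hir. apply (HEm (pc i)); trivial. unfold tx.
      destruct (Hx i) as (a & Ha & ->).
      destruct (HA (pc i)) as (_ & _ & HF & _).
      assert (HXa : Xs (fst (Cantor.of_nat (pc i))) a) by now apply (proj1 (Forall_forall _ _) HF).
      destruct (HT (fst (Cantor.of_nat (pc i)))) as ((_ & Hs) & _). unfold T'.
      rewrite Hs; trivial; [|now apply Hsub]. apply HE. apply HEL.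
      apply (in_map (T' (pc i))). trivial.
    + apply delta_sym.
    + now apply delta_ge.
    + intros i j Hij Hp. unfold delta. destruct (Nat.eq_dec (pc i) (pc j)); [|congruence].
      pose proof (HXx j) as Hxj. rewrite <- Hp in Hxj.
      destruct (HT (fst (Cantor.of_nat (pc i)))) as (Hlin & Hn).
      unfold tx, T'. rewrite <- Hp, <- (linear_on_sub _ _ _ _ (Hsub _) Hlin) by auto.
      apply Hn. now apply subspace_sub.
    + apply delta_diff.
    + now apply delta_le.
    + now apply path_length_delta.
Qed.
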